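(* Let $X=\ell^p(\mathbb{N})$ (respectively $X=\ell^p(\mathbb{Z})$) with $1<p<\infty$, and let $N>2$ be an integer. For each integer $i$ with $1\leq i\leq N$ let $T_i=T_{f_i,w^{(i)}}$ be a unilateral (respectively bilateral) weighted pseudo-shift on $X$. Then $T_1,\dots,T_N$ are disjoint reiteratively hypercyclic if and only if each $T_i$ is reiteratively hypercyclic and $T_1,\dots,T_N$ are disjoint hypercyclic.
   Context: $(e_j)$ is the canonical basis. A weighted pseudo-shift on $\ell^p(\mathbb{Z})$ (bilateral) is given by an invertible map $f:\mathbb{Z}\to\mathbb{Z}$ and a bounded nonzero weight sequence $w=(w_j)_{j\in\mathbb{Z}}$ via $T_{f,w}\big(\sum_j x_je_j\big)=\sum_j w_{f(j)}x_{f(j)}e_j$; a unilateral weighted pseudo-shift on $\ell^p(\mathbb{N})$ is defined by the same formula with $f:\mathbb{N}\to\mathbb{N}$ injective and $w=(w_j)_{j\in\mathbb{N}}$ bounded and nonzero. For $T$ an operator, $x\in X$, $U\subset X$: $N(x,U)=\{n\in\mathbb{N}:T^nx\in U\}$. Upper Banach density: $\overline{Bd}(A)=\lim_{N\to\infty}\limsup_{m\to\infty}\frac{\#(A\cap[m+1,m+N])}{N}$. $T$ is reiteratively hypercyclic if some $x$ satisfies $\overline{Bd}(N(x,U))>0$ for every non-empty open $U$. $T_1,\dots,T_N$ are disjoint hypercyclic (resp. disjoint reiteratively hypercyclic) if $T_1\oplus\cdots\oplus T_N$ on $X^N$ has a hypercyclic (resp. reiteratively hypercyclic) vector of the form $(x,\dots,x)$.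 *)

(* Defs.v *)
From Stdlib Require Import Reals Lra ZArith List ClassicalEpsilon.
From Coquelicot Require Import Coquelicot.
Open Scope R_scope.

(** Real power a^q for a >= 0 (with 0^q = 0, q > 0). *)
Definition rpow (a q : R) : R := if Rle_dec a 0 then 0 else Rpower a q.

Definition lp_bound {I : Type} (p : R) (x : I -> C) (M : R) : Prop :=
  forall l : list I, NoDup l ->
    fold_right Rplus 0 (map (fun j => rpow (Cmod (x j)) p) l) <= M.

Definition in_lp {I : Type} (p : R) (x : I -> C) : Prop := exists M, lp_bound p x M.

(** ||x - y||_p < eps   (i.e. sup of finite partial sums of |x_j-y_j|^p < eps^p) *)
Definition lp_dist_lt {I : Type} (p : R) (x y : I -> C) (eps : R) : Prop :=
  exists d, d < rpow eps p /\ lp_bound p (fun j => Cminus (x j) (y j)) d.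

Definition is_open {V : Type} (S : V -> Prop) (near : V -> V -> R -> Prop)
  (U : V -> Prop) : Prop :=
  (forall u, U u -> S u) /\
  (forall u, U u -> exists eps, 0 < eps /\ forall v, S v -> near u v eps -> U v).

Definition X_open {I : Type} (p : R) (U : (I -> C) -> Prop) : Prop :=
  is_open (in_lp p) (lp_dist_lt p) U.

(** X^N with the product topology (max-metric); tuples indexed by 1..N *)
Definition XN_open {I : Type} (p : R) (N : nat) (U : (nat -> I -> C) -> Prop) : Prop :=
  is_open (fun u => forall i, (1 <= i <= N)%nat -> in_lp p (u i))
          (fun u v eps => forall i, (1 <= i <= N)%nat -> lp_dist_lt p (u i) (v i) eps)
          U.

Definition indic (P : Prop) : R :=
  if excluded_middle_informative P then 1 else 0.

(** #(A ∩ [m+1, m+n+1]) *)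
Definition window_count (A : nat -> Prop) (m n : nat) : R :=
  sum_f_R0 (fun k => indic (A (m + 1 + k)%nat)) n.

(** \overline{Bd}(A) = lim_{L->oo} limsup_{m->oo} #(A ∩ [m+1, m+L]) / L   (L = n+1) *)
Definition upper_Bd (A : nat -> Prop) : Rbar :=
  Lim_seq (fun n => real (LimSup_seq (fun m => window_count A m n / INR (n + 1)))).

Definition pseudo_shift {I : Type} (f : I -> I) (w : I -> C) (x : I -> C) : I -> C :=
  fun j => Cmult (w (f j)) (x (f j)).

Definition bounded_nonzero_weight {I : Type} (w : I -> C) : Prop :=
  (exists M, forall j, Cmod (w j) <= M) /\ (forall j, w j <> 0%C).

Definition unilateral_wps_data (f : nat -> nat) (w : nat -> C) : Prop :=
  (forall j k, f j = f k -> j = k) /\ bounded_nonzero_weight w.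

Definition bilateral_wps_data (f : Z -> Z) (w : Z -> C) : Prop :=
  (exists g : Z -> Z, (forall j, g (f j) = j) /\ (forall j, f (g j) = j))
  /\ bounded_nonzero_weight w.

Definition hypercyclic {I : Type} (p : R) (T : (I -> C) -> (I -> C)) : Prop :=
  exists x, in_lp p x /\
    forall U, X_open p U -> (exists u, U u) -> exists n, U (Nat.iter n T x).

Definition reit_hypercyclic {I : Type} (p : R) (T : (I -> C) -> (I -> C)) : Prop :=
  exists x, in_lp p x /\
    forall U, X_open p U -> (exists u, U u) ->
      Rbar_lt 0 (upper_Bd (fun n => U (Nat.iter n T x))).

(** T_1,...,T_N disjoint hypercyclic: T_1 ⊕ ... ⊕ T_N has a hypercyclic vector (x,...,x) *)
Definition disj_hypercyclic {I : Type} (p : R) (N : nat)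
  (T : nat -> (I -> C) -> (I -> C)) : Prop :=
  exists x, in_lp p x /\
    forall U, XN_open p N U -> (exists u, U u) ->
      exists n, U (fun i => Nat.iter n (T i) x).

Definition disj_reit_hypercyclic {I : Type} (p : R) (N : nat)
  (T : nat -> (I -> C) -> (I -> C)) : Prop :=
  exists x, in_lp p x /\
    forall U, XN_open p N U -> (exists u, U u) ->
      Rbar_lt 0 (upper_Bd (fun n => U (fun i => Nat.iter n (T i) x))).

(* Main.v *)
Require Import Defs.
From Stdlib Require Import Reals ZArith List Lra Lia.
From Stdlib Require Import Classical ClassicalEpsilon.
From Stdlib Require Import FunctionalExtensionality PropExtensionality.
From Coquelicot Require Import Coquelicot.
Open Scope R_scope.
Set Bullet Behavior "Strict Subproofs".

(** If [x] is a hypercyclic vector of [T_1 + ... + T_N] and the open set [U] contains a periodic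
    tuple, then the orbit of [x] shadows that tuple for arbitrarily long times, so its visits to
    [U] have positive upper Banach density. Hence it suffices that each [T = T_{f,w}] has, for
    every large [n], vectors of period [n] near any given vector.

    Let [a] be the formal fixed vector of [T] supported on the [f]-orbit of [j], with [a_j = 1].
    If [a] is in l^p, its restrictions to the points of the orbit whose distance to [j] is a
    multiple of [n] have period [n] and tend to [e_j]. Following Bayart and Ruzsa, [a] is in l^p
    when [T] is reiteratively hypercyclic: for a suitable [x] the set [A] of times [u] at which
    [T^u x] is close to [e_j] has positive upper Banach density, and for [u] in [A] the p-th
    powers of the [a_i] at positions [v - u], [v] in [A], have a uniformly bounded sum. Summing
    over [u] in a long window bounds the sum over all positions that are frequent differences
    of [A]; these are syndetic, and the boundedness of [w] fills the gaps. *)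

(** * Finite sums and real powers *)

Definition lsum {I : Type} (g : I -> R) (l : list I) : R := fold_right Rplus 0 (map g l).

Lemma lsum_cons {I} (g : I -> R) x l : lsum g (x :: l) = g x + lsum g l.
Proof. reflexivity. Qed.

Lemma lsum_app {I} (g : I -> R) l l' : lsum g (l ++ l') = lsum g l + lsum g l'.
Proof.
  induction l as [|x l IH]; simpl.
  - unfold lsum; simpl; lra.
  - rewrite !lsum_cons, IH; lra.
Qed.

Lemma lsum_le {I} (g h : I -> R) l :
  (forall x, In x l -> g x <= h x) -> lsum g l <= lsum h l.
Proof.
  induction l as [|x l IH]; intros H.
  - apply Rle_refl.
  - rewrite !lsum_cons. apply Rplus_le_compat.
    + apply H; now left.
    + apply IH; intros y Hy; apply H; now right.
Qed.

Lemma lsum_ext {I} (g h : I -> R) l :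
  (forall x, In x l -> g x = h x) -> lsum g l = lsum h l.
Proof.
  intros H; apply Rle_antisym; apply lsum_le; intros x Hx; rewrite (H x Hx); lra.
Qed.

Lemma lsum_const {I} (c : R) (l : list I) : lsum (fun _ => c) l = INR (length l) * c.
Proof.
  induction l as [|x l IH].
  - unfold lsum; simpl; lra.
  - rewrite lsum_cons, IH. change (length (x :: l)) with (S (length l)). rewrite S_INR. lra.
Qed.

Lemma lsum_nonneg {I} (g : I -> R) l : (forall x, In x l -> 0 <= g x) -> 0 <= lsum g l.
Proof.
  intros H. replace 0 with (lsum (fun _ : I => 0) l).
  - now apply lsum_le.
  - rewrite lsum_const; lra.
Qed.

Lemma lsum_scal {I} (c : R) (g : I -> R) l : lsum (fun x => c * g x) l = c * lsum g l.
Proof.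
  induction l as [|x l IH].
  - unfold lsum; simpl; lra.
  - rewrite !lsum_cons, IH; lra.
Qed.

Lemma lsum_plus {I} (g h : I -> R) l : lsum (fun x => g x + h x) l = lsum g l + lsum h l.
Proof.
  induction l as [|x l IH].
  - unfold lsum; simpl; lra.
  - rewrite !lsum_cons, IH; lra.
Qed.

Lemma lsum_map {I J} (g : J -> R) (h : I -> J) l : lsum g (map h l) = lsum (fun x => g (h x)) l.
Proof. unfold lsum; now rewrite map_map. Qed.

Lemma lsum_swap {I J} (g : I -> J -> R) l l' :
  lsum (fun x => lsum (g x) l') l = lsum (fun y => lsum (fun x => g x y) l) l'.
Proof.
  induction l as [|x l IH].
  - unfold lsum at 1; simpl. symmetry.
    rewrite (lsum_ext _ (fun _ => 0)) by reflexivity. rewrite lsum_const; lra.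
  - rewrite lsum_cons, IH, <- lsum_plus. reflexivity.
Qed.

Lemma lsum_ge_term {I} (g : I -> R) l x :
  (forall y, In y l -> 0 <= g y) -> In x l -> g x <= lsum g l.
Proof.
  intros Hg Hx. apply in_split in Hx as (l1 & l2 & ->).
  rewrite lsum_app, lsum_cons.
  assert (0 <= lsum g l1) by (apply lsum_nonneg; intros; apply Hg, in_or_app; now left).
  assert (0 <= lsum g l2)
    by (apply lsum_nonneg; intros; apply Hg, in_or_app; right; now right).
  lra.
Qed.

(** Each entry of [l] with nonzero value is cut out of [l'] in turn; as [l] has no repetitions, the
    entries still to be matched survive the cut. *)
Lemma lsum_le_support {I} (g : I -> R) l l' :
  NoDup l -> (forall x, 0 <= g x) -> (forall x, In x l -> g x <> 0 -> In x l') ->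
  lsum g l <= lsum g l'.
Proof.
  intros Hnd Hg. revert l'. induction Hnd as [|x l Hx Hnd IH]; intros l' Hl.
  - apply lsum_nonneg; auto.
  - rewrite lsum_cons. destruct (Req_dec (g x) 0) as [E|E].
    + rewrite E, Rplus_0_l. apply IH. intros y Hy; apply Hl; now right.
    + destruct (in_split x l' (Hl x (or_introl eq_refl) E)) as (l1 & l2 & ->).
      assert (lsum g l <= lsum g (l1 ++ l2)) as H.
      { apply IH. intros y Hy Ey.
        specialize (Hl y (or_intror Hy) Ey).
        apply in_app_or in Hl as [?|[?|?]]; apply in_or_app; auto.
        subst; contradiction. }
      rewrite lsum_app in H. rewrite lsum_app, lsum_cons. lra.
Qed.

Lemma rpow_nonneg a q : 0 <= rpow a q.
Proof.
  unfold rpow; destruct (Rle_dec a 0); [lra|]. unfold Rpower; apply Rlt_le, exp_pos.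
Qed.

Lemma rpow_0 q : rpow 0 q = 0.
Proof. unfold rpow; destruct (Rle_dec 0 0); lra. Qed.

Lemma rpow_Rpower a q : 0 < a -> rpow a q = Rpower a q.
Proof. intros; unfold rpow; destruct (Rle_dec a 0); lra. Qed.

Lemma rpow_pos a q : 0 < a -> 0 < rpow a q.
Proof. intros; rewrite rpow_Rpower by assumption; apply exp_pos. Qed.

Lemma rpow_mult a b q : 0 <= a -> 0 <= b -> rpow (a * b) q = rpow a q * rpow b q.
Proof.
  intros [Ha|<-] [Hb|<-]; rewrite ?Rmult_0_l, ?Rmult_0_r, ?rpow_0; try lra.
  rewrite !rpow_Rpower by (try apply Rmult_lt_0_compat; assumption).
  now rewrite Rpower_mult_distr.
Qed.

Lemma rpow_le a b q : 0 < q -> a <= b -> rpow a q <= rpow b q.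
Proof.
  intros Hq Hab. destruct (Rle_dec a 0) as [Ha|Ha].
  - unfold rpow at 1; destruct (Rle_dec a 0); [apply rpow_nonneg | lra].
  - rewrite !rpow_Rpower by lra. apply Rle_Rpower_l; lra.
Qed.

Lemma rpow_lt a b q : 0 < q -> 0 <= a -> a < b -> rpow a q < rpow b q.
Proof.
  intros Hq [Ha|<-] Hab.
  - rewrite !rpow_Rpower by lra. unfold Rpower. apply exp_increasing.
    apply Rmult_lt_compat_l; [assumption|]. now apply ln_increasing.
  - rewrite rpow_0; now apply rpow_pos.
Qed.

Lemma rpow_lt_inv a b q : 0 < q -> rpow a q < rpow b q -> a < b.
Proof.
  intros Hq H. apply Rnot_le_lt; intros Hba. apply (rpow_le _ _ q) in Hba; lra.
Qed.

Lemma rpow_le_inv a b q : 0 < q -> 0 <= b -> rpow a q <= rpow b q -> a <= b.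
Proof.
  intros Hq Hb H. apply Rnot_lt_le; intros Hba. apply (rpow_lt _ _ q) in Hba; lra.
Qed.

Lemma rpow_surj d q : 0 < q -> 0 <= d -> exists r, 0 <= r /\ rpow r q = d.
Proof.
  intros Hq [Hd|<-].
  - exists (Rpower d (/ q)). assert (0 < Rpower d (/ q)) by apply exp_pos.
    split; [lra|]. rewrite rpow_Rpower, Rpower_mult by assumption.
    rewrite Rinv_l by lra. now apply Rpower_1.
  - exists 0. split; [lra | apply rpow_0].
Qed.

(** The graph of [u^p] lies above its tangent at [1]. With [u = exp b] this follows from
    [1 + z <= exp z] at [z = (p - 1) b] and at [z = - b]. *)
Lemma rpow_bernoulli p u : 1 < p -> 0 <= u -> 1 + p * (u - 1) <= rpow u p.
Proof.
  intros Hp [Hu|<-].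
  - rewrite rpow_Rpower by assumption. unfold Rpower.
    set (b := ln u). replace u with (exp b) by (unfold b; now apply exp_ln).
    (* convexity of exp at b, between 0 and p b *)
    assert (H1 : 1 + (p - 1) * b <= exp ((p - 1) * b)) by apply exp_ineq1_le.
    assert (H2 : 1 + - b <= exp (- b)) by apply exp_ineq1_le.
    replace (p * b) with ((p - 1) * b + b) by ring.
    rewrite exp_plus.
    assert (Hb : 0 < exp b) by apply exp_pos.
    assert (E : exp (- b) * exp b = 1) by (rewrite <- exp_plus, Rplus_opp_l; apply exp_0).
    apply (Rmult_le_compat_r (exp b)) in H1, H2; try lra.
    rewrite E in H2. apply (Rmult_le_compat_l (p - 1)) in H2; lra.
  - rewrite rpow_0; lra.
Qed.

(** Rescaled to the point [s], the Bernoulli inequality bounds [z^p] below by its tangent at [s];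
    averaging over [z = u] and [z = v] cancels the linear terms. *)
Lemma rpow_convex p t u v : 1 < p -> 0 <= t <= 1 -> 0 <= u -> 0 <= v ->
  rpow (t * u + (1 - t) * v) p <= t * rpow u p + (1 - t) * rpow v p.
Proof.
  intros Hp Ht Hu Hv. set (s := t * u + (1 - t) * v).
  assert (Hs : 0 <= s) by (unfold s; nra).
  assert (Hu' := rpow_nonneg u p). assert (Hv' := rpow_nonneg v p).
  destruct Hs as [Hs|Hs].
  - assert (K : forall z, 0 <= z -> rpow s p * (1 + p * (z / s - 1)) <= rpow z p).
    { intros z Hz. assert (0 <= z / s) by (apply Rdiv_le_0_compat; lra).
      replace z with (s * (z / s)) at 2 by (field; lra).
      rewrite rpow_mult by lra.
      apply Rmult_le_compat_l; [apply rpow_nonneg | now apply rpow_bernoulli]. }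
    apply Rle_trans with
      (t * (rpow s p * (1 + p * (u / s - 1))) + (1 - t) * (rpow s p * (1 + p * (v / s - 1)))).
    + right. transitivity (rpow s p * (1 + p * ((t * u + (1 - t) * v) / s - 1))).
      * fold s. field. lra.
      * field. lra.
    + apply Rplus_le_compat; apply Rmult_le_compat_l; auto; lra.
  - rewrite <- Hs, rpow_0. nra.
Qed.

(** * The norm of l^p *)

(* [||x||_p <= r]: Minkowski's inequality needs radii, while [lp_bound] speaks of p-th powers. *)
Definition norm_le {I : Type} (p : R) (x : I -> C) (r : R) : Prop :=
  0 <= r /\ lp_bound p x (rpow r p).

Section LpNorm.
Context {I : Type} (p : R) (Hp : 1 < p).
Implicit Types (x y z : I -> C) (r s : R).

Lemma lp_boundE x M :
  lp_bound p x M <-> forall l, NoDup l -> lsum (fun j => rpow (Cmod (x j)) p) l <= M.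
Proof. reflexivity. Qed.

Lemma norm_le_coord x r j : norm_le p x r -> Cmod (x j) <= r.
Proof.
  intros [Hr Hx]. apply (rpow_le_inv _ _ p); [lra | assumption |].
  specialize (Hx (j :: nil)). simpl in Hx. rewrite Rplus_0_r in Hx.
  apply Hx. repeat constructor. intros [].
Qed.

Lemma norm_le_weaken x r s : norm_le p x r -> r <= s -> norm_le p x s.
Proof.
  intros [Hr Hx] Hrs. split; [lra|]. intros l Hl.
  eapply Rle_trans; [now apply Hx | apply rpow_le; lra].
Qed.

Lemma norm_le_dom x y r c : 0 <= c -> (forall i, Cmod (y i) <= c * Cmod (x i)) ->
  norm_le p x r -> norm_le p y (c * r).
Proof.
  intros Hc Hd [Hr Hx]. split; [nra|]. rewrite lp_boundE in *. intros l Hl.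
  rewrite rpow_mult by assumption.
  eapply Rle_trans.
  - apply lsum_le. intros i _. eapply Rle_trans; [apply rpow_le; [lra | apply Hd]|].
    rewrite rpow_mult by (try apply Cmod_ge_0; assumption). apply Rle_refl.
  - rewrite lsum_scal. apply Rmult_le_compat_l; [apply rpow_nonneg | auto].
Qed.

Lemma norm_le_dom1 x y r : (forall i, Cmod (y i) <= Cmod (x i)) ->
  norm_le p x r -> norm_le p y r.
Proof.
  intros Hd Hx. rewrite <- (Rmult_1_l r). apply norm_le_dom with x; [lra| |assumption].
  intros i; rewrite Rmult_1_l; apply Hd.
Qed.

(* Minkowski: [|x + y| <= (r + s) (t |x| / r + (1 - t) |y| / s)] with [t = r / (r + s)],
   and [t -> t^p] is convex. *)
Lemma norm_le_add x y r s : norm_le p x r -> norm_le p y s ->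
  norm_le p (fun i => Cplus (x i) (y i)) (r + s).
Proof.
  intros Hx Hy. destruct (proj1 Hx) as [Hr|<-].
  (* For [r = 0] every coordinate of [x] vanishes. This case and [s = 0] are split off because the
     convexity argument divides by both radii. *)
  2:{ rewrite Rplus_0_l. apply norm_le_dom1 with y; [|assumption].
      intros i. eapply Rle_trans; [apply Cmod_triangle|].
      assert (H := norm_le_coord _ _ i Hx). lra. }
  destruct (proj1 Hy) as [Hs|<-].
  2:{ rewrite Rplus_0_r. apply norm_le_dom1 with x; [|assumption].
      intros i. eapply Rle_trans; [apply Cmod_triangle|].
      assert (H := norm_le_coord _ _ i Hy). lra. }
  split; [lra|]. rewrite lp_boundE. intros l Hl.
  set (t := r / (r + s)).
  assert (Ht : 0 <= t <= 1).
  { unfold t; split.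
    - apply Rdiv_le_0_compat; lra.
    - apply Rmult_le_reg_r with (r + s); [lra|]. unfold Rdiv.
      rewrite Rmult_assoc, Rinv_l by lra. lra. }
  assert (K : forall z q, 0 < q -> norm_le p z q ->
             lsum (fun i => rpow (Cmod (z i) * / q) p) l <= 1).
  { intros z q Hq [_ Hz]. assert (Hq' := Rinv_0_lt_compat _ Hq).
    rewrite (lsum_ext _ (fun i => rpow (/ q) p * rpow (Cmod (z i)) p)).
    - rewrite lsum_scal. apply Rle_trans with (rpow (/ q) p * rpow q p).
      + apply Rmult_le_compat_l; [apply rpow_nonneg | now apply Hz].
      + rewrite <- rpow_mult, Rinv_l, rpow_Rpower by lra.
        unfold Rpower; rewrite ln_1, Rmult_0_r, exp_0; lra.
    - intros i _. rewrite rpow_mult by (try apply Cmod_ge_0; lra). ring. }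
  apply Rle_trans with
    (rpow (r + s) p *
     lsum (fun i => t * rpow (Cmod (x i) * / r) p + (1 - t) * rpow (Cmod (y i) * / s) p) l).
  - rewrite <- lsum_scal. apply lsum_le. intros i _.
    assert (H1 : 0 <= Cmod (x i) * / r)
      by (apply Rmult_le_pos; [apply Cmod_ge_0 | apply Rlt_le, Rinv_0_lt_compat; lra]).
    assert (H2 : 0 <= Cmod (y i) * / s)
      by (apply Rmult_le_pos; [apply Cmod_ge_0 | apply Rlt_le, Rinv_0_lt_compat; lra]).
    apply Rle_trans with
      (rpow ((r + s) * (t * (Cmod (x i) * / r) + (1 - t) * (Cmod (y i) * / s))) p).
    + apply rpow_le; [lra|]. eapply Rle_trans; [apply Cmod_triangle|].
      right. unfold t. field. lra.
    + rewrite rpow_mult; [|lra|nra].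
      apply Rmult_le_compat_l; [apply rpow_nonneg|]. now apply rpow_convex.
  - rewrite lsum_plus, !lsum_scal. rewrite <- (Rmult_1_r (rpow (r + s) p)) at 2.
    apply Rmult_le_compat_l; [apply rpow_nonneg|].
    assert (Kx := K x r Hr Hx). assert (Ky := K y s Hs Hy). nra.
Qed.

Lemma norm_le_zero : norm_le p (fun _ : I => RtoC 0) 0.
Proof.
  split; [lra|]. rewrite lp_boundE. intros l _.
  rewrite Cmod_0, rpow_0, lsum_const. lra.
Qed.

(** The empty list forces [0 <= M], so the bound on p-th powers has a p-th root to serve as
    radius. *)
Lemma in_lp_norm x : in_lp p x <-> exists r, norm_le p x r.
Proof.
  split.
  - intros [M HM]. assert (0 <= M) by (apply (HM nil); constructor).
    destruct (rpow_surj M p) as (r & Hr & E); [lra | assumption |].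
    exists r. split; [assumption|]. now rewrite E.
  - intros [r [_ Hr]]. now exists (rpow r p).
Qed.

Lemma lp_dist_norm x y e :
  lp_dist_lt p x y e <-> exists r, r < e /\ norm_le p (fun i => Cminus (x i) (y i)) r.
Proof.
  split.
  - intros (d & Hd & HM). assert (0 <= d) by (apply (HM nil); constructor).
    destruct (rpow_surj d p) as (r & Hr & E); [lra | assumption |].
    exists r. rewrite <- E in Hd. apply rpow_lt_inv in Hd; [|lra].
    split; [assumption|]. split; [assumption|]. now rewrite E.
  - intros (r & Hr & H0 & HM). exists (rpow r p). split; [|assumption].
    apply rpow_lt; lra.
Qed.

Lemma lp_dist_refl x e : 0 < e -> lp_dist_lt p x x e.
Proof.
  intros He. apply lp_dist_norm. exists 0. split; [assumption|].
  apply norm_le_dom1 with (fun _ => RtoC 0); [|apply norm_le_zero].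
  intros i. replace (Cminus (x i) (x i)) with (RtoC 0) by ring. apply Rle_refl.
Qed.

Lemma lp_dist_triangle x y z e1 e2 :
  lp_dist_lt p x y e1 -> lp_dist_lt p y z e2 -> lp_dist_lt p x z (e1 + e2).
Proof.
  rewrite !lp_dist_norm. intros (r & Hr & Hx) (s & Hs & Hy).
  exists (r + s). split; [lra|].
  eapply norm_le_dom1; [|exact (norm_le_add _ _ _ _ Hx Hy)].
  intros i; right; apply f_equal; simpl; ring.
Qed.

Lemma lp_dist_coord x y e j : lp_dist_lt p x y e -> Cmod (Cminus (x j) (y j)) < e.
Proof.
  intros (r & Hr & H)%lp_dist_norm. apply (norm_le_coord _ _ j) in H. lra.
Qed.

Lemma in_lp_zero : in_lp p (fun _ : I => RtoC 0).
Proof. apply in_lp_norm. exists 0. apply norm_le_zero. Qed.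

Lemma in_lp_add x y : in_lp p x -> in_lp p y -> in_lp p (fun i => Cplus (x i) (y i)).
Proof.
  rewrite !in_lp_norm. intros [r Hr] [s Hs]. exists (r + s). now apply norm_le_add.
Qed.

Lemma in_lp_scal c x : in_lp p x -> in_lp p (fun i => Cmult c (x i)).
Proof.
  rewrite !in_lp_norm. intros [r Hr]. exists (Cmod c * r).
  apply norm_le_dom with x; [apply Cmod_ge_0 | | assumption].
  intros i; rewrite Cmod_mult; apply Rle_refl.
Qed.

Lemma in_lp_dom x y : (forall i, Cmod (y i) <= Cmod (x i)) -> in_lp p x -> in_lp p y.
Proof.
  rewrite !in_lp_norm. intros H [r Hr]. exists r. now apply norm_le_dom1 with x.
Qed.

(** * Restrictions, tails and unit vectors *)

Definition restr (P : I -> Prop) x : I -> C :=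
  fun i => if excluded_middle_informative (P i) then x i else RtoC 0.

Lemma restr_in (P : I -> Prop) x i : P i -> restr P x i = x i.
Proof. intros H. unfold restr. now destruct excluded_middle_informative. Qed.

Lemma restr_out (P : I -> Prop) x i : ~ P i -> restr P x i = RtoC 0.
Proof. intros H. unfold restr. now destruct excluded_middle_informative. Qed.

Lemma restr_dom (P : I -> Prop) x i : Cmod (restr P x i) <= Cmod (x i).
Proof.
  unfold restr; destruct excluded_middle_informative; [lra|].
  rewrite Cmod_0; apply Cmod_ge_0.
Qed.

(** A finite sum within [e^p] of the supremum of all finite sums leaves at most [e^p] for any list
    disjoint from it. *)
Lemma lp_tail x e : in_lp p x -> 0 < e ->
  exists l, norm_le p (restr (fun i => ~ In i l) x) e.
Proof.
  intros [M HM] He. set (h := fun i => rpow (Cmod (x i)) p).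
  assert (He' : 0 < rpow e p) by now apply rpow_pos.
  set (E := fun v => exists l, NoDup l /\ v = lsum h l).
  destruct (completeness E) as [S [Hub Hlub]].
  { exists M. intros v (l & Hl & ->). now apply HM. }
  { exists 0, nil. split; [constructor | reflexivity]. }
  assert (exists l, NoDup l /\ S - rpow e p < lsum h l) as (l & Hl & HS).
  { apply NNPP; intros Hn. assert (S <= S - rpow e p); [|lra].
    apply Hlub. intros v (l & Hl & ->). apply Rnot_lt_le; intros Hlt.
    apply Hn; now exists l. }
  exists l. split; [lra|]. rewrite lp_boundE. intros l' Hl'.
  set (D := fun i => if excluded_middle_informative (In i l) then false else true).
  assert (HD : forall i, D i = true <-> ~ In i l)
    by (intros i; unfold D; destruct excluded_middle_informative; intuition congruence).
  assert (H1 : lsum h (l ++ filter D l') <= S).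
  { apply Hub. eexists; split; [|reflexivity].
    apply NoDup_app; [assumption | now apply NoDup_filter |].
    intros i Hi [_ Hi']%filter_In. now apply HD in Hi'. }
  rewrite lsum_app in H1.
  apply Rle_trans with (lsum h (filter D l')); [|lra].
  eapply Rle_trans; [apply (lsum_le_support _ _ (filter D l') Hl')|].
  - intros i; apply rpow_nonneg.
  - intros i Hi Hne. apply filter_In. split; [assumption|]. apply HD. intros Hil.
    apply Hne. rewrite restr_out by tauto. rewrite Cmod_0; apply rpow_0.
  - apply lsum_le. intros i _. apply rpow_le; [lra | apply restr_dom].
Qed.

Definition unit_vec (j : I) : I -> C := restr (fun i => i = j) (fun _ => RtoC 1).

Lemma norm_le_unit_vec j : norm_le p (unit_vec j) 1.
Proof.
  split; [lra|]. rewrite lp_boundE. intros l Hl.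
  eapply Rle_trans; [apply (lsum_le_support _ _ (j :: nil) Hl)|].
  - intros i; apply rpow_nonneg.
  - intros i _ Hi. left. apply NNPP; intros Hij. apply Hi.
    unfold unit_vec. rewrite restr_out by congruence. rewrite Cmod_0; apply rpow_0.
  - unfold lsum; simpl. rewrite Rplus_0_r. apply rpow_le; [lra|].
    unfold unit_vec. rewrite restr_in by reflexivity. rewrite Cmod_1; lra.
Qed.

Lemma in_lp_unit_vec j : in_lp p (unit_vec j).
Proof. apply in_lp_norm. exists 1. apply norm_le_unit_vec. Qed.

(** Membership in l^p is part of the ball because [is_open] only admits subsets of the space. *)
Lemma X_open_ball x e : X_open p (fun y => in_lp p y /\ lp_dist_lt p x y e).
Proof.
  split; [tauto|]. intros u (Hu & (r & Hr & Hn)%lp_dist_norm).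
  exists (e - r). split; [lra|]. intros v Hv Huv. split; [assumption|].
  apply lp_dist_norm in Huv as (s & Hs & Hn').
  apply lp_dist_norm. exists (r + s). split; [lra|].
  eapply norm_le_dom1; [|exact (norm_le_add _ _ _ _ Hn Hn')].
  intros i; right; apply f_equal; simpl; ring.
Qed.

End LpNorm.

(** * Upper Banach density *)

Lemma indic_true (P : Prop) : P -> indic P = 1.
Proof. intros H. unfold indic. now destruct excluded_middle_informative. Qed.

Lemma indic_false (P : Prop) : ~ P -> indic P = 0.
Proof. intros H. unfold indic. now destruct excluded_middle_informative. Qed.

Lemma indic_01 (P : Prop) : indic P = 0 \/ indic P = 1.
Proof. unfold indic. destruct excluded_middle_informative; auto. Qed.

Lemma indic_nonneg (P : Prop) : 0 <= indic P.
Proof. destruct (indic_01 P); lra. Qed.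

Lemma sum_f_R0_lsum (g : nat -> R) n : sum_f_R0 g n = lsum g (seq 0 (n + 1)).
Proof.
  induction n as [|n IH].
  - unfold lsum; simpl; lra.
  - rewrite tech5, IH. replace (S n + 1)%nat with (S (n + 1)) by lia.
    rewrite seq_S, lsum_app. replace (0 + (n + 1))%nat with (S n) by lia.
    unfold lsum at 3; simpl; lra.
Qed.

Lemma window_count_le A m n : window_count A m n <= INR (n + 1).
Proof.
  unfold window_count. rewrite sum_f_R0_lsum.
  apply Rle_trans with (lsum (fun _ => 1) (seq 0 (n + 1))).
  - apply lsum_le. intros k _. destruct (indic_01 (A (m + 1 + k)%nat)); lra.
  - rewrite lsum_const, length_seq. lra.
Qed.

Lemma is_LimSup_LimSup_seq u : is_LimSup_seq u (LimSup_seq u).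
Proof. exact (proj2_sig (ex_LimSup_seq u)). Qed.

(** Reduces the iterated limit to the finitary form used by the combinatorics: arbitrarily long
    windows filled to a fixed proportion. *)
Lemma upper_Bd_pos_dense A : Rbar_lt 0 (upper_Bd A) ->
  exists c, 0 < c /\
    forall n0, exists n m, (n0 <= n)%nat /\ c * INR (n + 1) <= window_count A m n.
Proof.
  unfold upper_Bd. set (u := fun n => real _). intros H.
  assert (exists c, 0 < c /\ Rbar_lt c (Lim_seq u)) as (c & Hc & Hlt).
  { destruct (Lim_seq u) as [l| |]; simpl in H.
    - exists (l / 2). simpl. lra.
    - exists 1. simpl. lra.
    - contradiction. }
  exists c. split; [assumption|]. intros n0.
  assert (exists n, (n0 <= n)%nat /\ c < u n) as (n & Hn & Hu).
  { apply NNPP; intros Hno. apply (Rbar_lt_not_le _ _ Hlt).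
    rewrite <- (Lim_seq_const c). apply Lim_seq_le_loc. exists n0. intros n Hn.
    apply Rnot_lt_le; intros Hcu. apply Hno; now exists n. }
  unfold u in Hu. set (v := fun m => _) in Hu.
  assert (Hv := is_LimSup_LimSup_seq v).
  (* [real] sends infinite values to [0], so [0 < c] and [Hu] force a finite limsup. *)
  destruct (LimSup_seq v) as [l| |]; simpl in Hu; try lra.
  assert (Hpos : 0 < l - c) by lra.
  destruct (proj1 (Hv (mkposreal _ Hpos)) 0%nat) as (m & _ & Hm).
  simpl in Hm. exists n, m. split; [assumption|].
  assert (0 < INR (n + 1)) by (apply lt_0_INR; lia).
  assert (Hm' : c < v m) by lra. unfold v in Hm'.
  apply Rlt_le. apply (Rmult_lt_compat_r (INR (n + 1))) in Hm'; [|assumption].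
  unfold Rdiv in Hm'. rewrite Rmult_assoc, Rinv_l in Hm' by lra. lra.
Qed.

(** Through this, reiterative hypercyclicity yields a dense orbit. *)
Lemma upper_Bd_pos_nonempty A : Rbar_lt 0 (upper_Bd A) -> exists n, A n.
Proof.
  intros (c & Hc & H)%upper_Bd_pos_dense. destruct (H 0%nat) as (n & m & _ & Hnm).
  apply NNPP; intros Hno.
  unfold window_count in Hnm. rewrite sum_f_R0_lsum in Hnm.
  rewrite (lsum_ext _ (fun _ => 0)), lsum_const in Hnm.
  - assert (0 < INR (n + 1)) by (apply lt_0_INR; lia). nra.
  - intros k _. apply indic_false. intros Hk. apply Hno. eauto.
Qed.

Lemma count_multiples d n : (0 < d)%nat ->
  sum_f_R0 (fun k => indic (Nat.divide d k)) n = INR (n / d + 1).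
Proof.
  intros Hd. induction n as [|n IH].
  - simpl sum_f_R0. rewrite indic_true by apply Nat.divide_0_r.
    rewrite Nat.Div0.div_0_l. reflexivity.
  - rewrite tech5, IH. destruct (classic (Nat.divide d (S n))) as [D|D].
    + rewrite indic_true by assumption. destruct D as [k Hk]. rewrite Hk.
      rewrite Nat.div_mul by lia.
      replace (n / d)%nat with (k - 1)%nat.
      * destruct k; [lia|]. rewrite <- S_INR. apply f_equal. lia.
      * apply Nat.div_unique with (d - 1)%nat; [lia|]. destruct k as [|k]; [lia|].
        replace (S k - 1)%nat with k by lia. nia.
    + rewrite indic_false by assumption. rewrite Rplus_0_r. f_equal. f_equal.
      assert (Hmod : (S n mod d <> 0)%nat)
        by (intros E; apply D, Nat.Lcm0.mod_divide, E).
      assert (E := Nat.div_mod (S n) d ltac:(lia)).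
      assert (Hlt := Nat.mod_upper_bound (S n) d ltac:(lia)).
      symmetry. apply Nat.div_unique with (S n mod d - 1)%nat; lia.
Qed.

(** For each window length, arbitrarily late windows contain a progression of step [d] filling a
    proportion of at least [1/d], so the limsup is at least [1/d]. *)
Lemma upper_Bd_pos_progressions (A : nat -> Prop) d : (0 < d)%nat ->
  (forall K m0, exists m, (m0 <= m)%nat /\ forall q, (q <= K)%nat -> A (m + q * d)%nat) ->
  Rbar_lt 0 (upper_Bd A).
Proof.
  intros Hd HA. assert (Hd' : 0 < INR d) by (apply lt_0_INR; lia).
  assert (Hid : 0 < / INR d) by now apply Rinv_0_lt_compat.
  apply Rbar_lt_le_trans with (/ INR d); [exact Hid|].
  unfold upper_Bd. rewrite <- (Lim_seq_const (/ INR d)).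
  apply Lim_seq_le_loc. exists 0%nat. intros n _.
  set (v := fun m => _). assert (Hv := is_LimSup_LimSup_seq v).
  assert (Hn : 0 < INR (n + 1)) by (apply lt_0_INR; lia).
  assert (Hfreq : forall m0, exists m, (m0 <= m)%nat /\ / INR d <= v m).
  (* Windows start one past their index: the window of index [m - 1] starts exactly at the first
     term [m], and [S m0] keeps this index at least [m0]. *)
  { intros m0. destruct (HA n (S m0)) as (m & Hm & Hq).
    exists (m - 1)%nat. split; [lia|]. unfold v.
    apply Rmult_le_reg_r with (INR d * INR (n + 1)); [nra|].
    replace (/ INR d * (INR d * INR (n + 1))) with (INR (n + 1)) by (field; lra).
    replace (window_count A (m - 1) n / INR (n + 1) * (INR d * INR (n + 1)))
      with (INR d * window_count A (m - 1) n) by (field; lra).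
    apply Rle_trans with (INR d * sum_f_R0 (fun k => indic (Nat.divide d k)) n).
    - rewrite count_multiples, <- mult_INR by assumption. apply le_INR.
      assert (E := Nat.div_mod n d ltac:(lia)).
      assert (Hlt := Nat.mod_upper_bound n d ltac:(lia)). nia.
    - apply Rmult_le_compat_l; [lra|]. unfold window_count. apply sum_Rle.
      intros k Hk. destruct (classic (Nat.divide d k)) as [[q ->]|D].
      + rewrite !indic_true; [lra| |now exists q].
        replace (m - 1 + 1 + q * d)%nat with (m + q * d)%nat by lia. apply Hq. nia.
      + rewrite (indic_false (Nat.divide d k)) by assumption. apply indic_nonneg. }
  destruct (LimSup_seq v) as [l| |]; simpl in Hv |- *.
  - apply Rnot_lt_le; intros Hl. assert (Hpos : 0 < / INR d - l) by lra.
    destruct (proj2 (Hv (mkposreal _ Hpos))) as (m0 & Hm0). simpl in Hm0.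
    destruct (Hfreq m0) as (m & Hm & Hvm). specialize (Hm0 m Hm). lra.
  (* An infinite limsup would be read as [0] by [real]; it is excluded because [v] never exceeds
     [1]. *)
  - exfalso. destruct (Hv 1 0%nat) as (m & _ & Hm). unfold v in Hm.
    assert (H := window_count_le A m n).
    apply (Rmult_lt_compat_r (INR (n + 1))) in Hm; [|assumption].
    unfold Rdiv in Hm. rewrite Rmult_assoc, Rinv_l in Hm by lra. lra.
  - exfalso. destruct (Hv 0) as (m0 & Hm0). destruct (Hfreq m0) as (m & Hm & Hvm).
    specialize (Hm0 m Hm). lra.
Qed.

(** * Differences of a set of positive upper Banach density *)

Definition zrange (lo : Z) (len : nat) : list Z :=
  map (fun k => (lo + Z.of_nat k)%Z) (seq 0 len).

Lemma in_zrange lo len z : In z (zrange lo len) <-> (lo <= z < lo + Z.of_nat len)%Z.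
Proof.
  unfold zrange. rewrite in_map_iff. split.
  - intros (k & <- & Hk%in_seq). lia.
  - intros H. exists (Z.to_nat (z - lo)). rewrite in_seq. lia.
Qed.

Lemma NoDup_zrange lo len : NoDup (zrange lo len).
Proof.
  apply NoDup_map_NoDup_ForallPairs; [|apply seq_NoDup]. intros a b _ _. lia.
Qed.

Lemma length_zrange lo len : length (zrange lo len) = len.
Proof. unfold zrange. now rewrite length_map, length_seq. Qed.

(** An autocorrelation: for [b] the indicator of a subset of [W], the number of pairs of its
    elements with difference [k]. *)
Definition corr (b : Z -> R) (W : list Z) (k : Z) : R :=
  lsum (fun u => b u * b (u + k)%Z) W.

(** For an indicator [b], the number of pairs of entries of [F] whose translates of the set both
    cover [t]. *)
Fixpoint overlap (b : Z -> R) (t : Z) (F : list Z) : R :=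
  match F with
  | nil => 0
  | k :: F' => b (t - k)%Z * lsum (fun q => b (t - q)%Z) F' + overlap b t F'
  end.

Section Windows.
Context (b : Z -> R) (W : list Z).
Context (b01 : forall z, b z = 0 \/ b z = 1) (HW : NoDup W).
Context (bW : forall z, b z <> 0 -> In z W).

Lemma ind_fun_nonneg z : 0 <= b z.
Proof. destruct (b01 z); lra. Qed.

Lemma corr_nonneg k : 0 <= corr b W k.
Proof. apply lsum_nonneg; intros; apply Rmult_le_pos; apply ind_fun_nonneg. Qed.

Lemma corr_0 : corr b W 0 = lsum b W.
Proof.
  apply lsum_ext. intros u _. rewrite Z.add_0_r. destruct (b01 u) as [-> | ->]; ring.
Qed.

(** Substitute [u = t - k]: translation is injective, and nonzero terms have [u] in [W] because [b]
    is supported there. *)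
Lemma corr_ge l k q : NoDup l ->
  lsum (fun t => b (t - k)%Z * b (t - q)%Z) l <= corr b W (k - q).
Proof.
  intros Hl. unfold corr.
  rewrite (lsum_ext _ (fun t => (fun u => b u * b (u + (k - q))%Z) (t - k)%Z)).
  2:{ intros t _. do 2 f_equal. lia. }
  rewrite <- lsum_map with (g := fun u => b u * b (u + (k - q))%Z).
  apply lsum_le_support.
  - apply NoDup_map_NoDup_ForallPairs; [|assumption]. intros x y _ _; lia.
  - intros u; apply Rmult_le_pos; apply ind_fun_nonneg.
  - intros u _ Hu. apply bW. intros E; apply Hu; rewrite E; ring.
Qed.

Lemma corr_sym k : corr b W (- k) <= corr b W k.
Proof.
  replace (corr b W k) with (corr b W (k - 0)) by (f_equal; lia).
  eapply Rle_trans; [|apply (corr_ge W k 0)].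
  - right. apply lsum_ext. intros u _. rewrite Rmult_comm. do 2 f_equal; lia.
  - assumption.
Qed.

Lemma overlap_nonneg t F : 0 <= overlap b t F.
Proof.
  induction F as [|k F IH]; simpl; [lra|].
  apply Rplus_le_le_0_compat; [|assumption].
  apply Rmult_le_pos; [apply ind_fun_nonneg|]. apply lsum_nonneg; intros; apply ind_fun_nonneg.
Qed.

(** If [c] translates cover [t], the overlap is [c (c - 1) / 2], which is at least [c - 1]. *)
Lemma bonferroni t F : lsum (fun k => b (t - k)%Z) F <= 1 + overlap b t F.
Proof.
  induction F as [|k F IH].
  - unfold lsum; simpl; lra.
  - rewrite lsum_cons; simpl. assert (H := overlap_nonneg t F).
    destruct (b01 (t - k)%Z) as [-> | ->]; lra.
Qed.

(** Summed over [t], each pair of translates contributes at most one correlation; the number of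
    pairs is bounded crudely by the square of the size of [F]. *)
Lemma lsum_overlap l F c : NoDup l -> NoDup F -> 0 <= c ->
  (forall k q, In k F -> In q F -> k <> q -> corr b W (k - q) <= c) ->
  lsum (fun t => overlap b t F) l <= INR (length F) * INR (length F) * c.
Proof.
  intros Hl HF Hc. induction HF as [|k F Hk HF IH]; intros Hcorr.
  - simpl. rewrite lsum_const; lra.
  - change (length (k :: F)) with (S (length F)). rewrite S_INR.
    simpl. rewrite lsum_plus.
    assert (H1 : lsum (fun t => overlap b t F) l <= INR (length F) * INR (length F) * c).
    { apply IH. intros; apply Hcorr; try right; assumption. }
    assert (H2 : lsum (fun t => b (t - k)%Z * lsum (fun q => b (t - q)%Z) F) l
                 <= INR (length F) * c).
    { rewrite (lsum_ext _ (fun t => lsum (fun q => b (t - k)%Z * b (t - q)%Z) F))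
        by (intros; now rewrite lsum_scal).
      rewrite lsum_swap, <- lsum_const. apply lsum_le. intros q Hq.
      eapply Rle_trans; [now apply corr_ge|].
      apply Hcorr; [now left | now right | congruence]. }
    assert (0 <= INR (length F)) by apply pos_INR. nra.
Qed.

(** The translates by [F] all lie in [l]. If they overlap little, their total mass cannot exceed the
    length of [l] by much: this is [bonferroni] summed over [l]. *)
Lemma packing_bound l F c : NoDup l -> NoDup F -> 0 <= c ->
  (forall k z, In k F -> In z W -> In (z + k)%Z l) ->
  (forall k q, In k F -> In q F -> k <> q -> corr b W (k - q) <= c) ->
  INR (length F) * lsum b W <= INR (length l) + INR (length F) * INR (length F) * c.
Proof.
  intros Hl HF Hc Hin Hcorr.
  eapply Rle_trans; [|apply Rplus_le_compat_l, (lsum_overlap l F c); assumption].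
  apply Rle_trans with (lsum (fun t => lsum (fun k => b (t - k)%Z) F) l).
  - rewrite lsum_swap, <- lsum_const. apply lsum_le. intros k Hk.
    rewrite (lsum_ext b (fun z => (fun t => b (t - k)%Z) (z + k)%Z))
      by (intros; f_equal; lia).
    rewrite <- lsum_map with (g := fun t => b (t - k)%Z).
    apply lsum_le_support.
    + apply NoDup_map_NoDup_ForallPairs; [|assumption]. intros x y _ _; lia.
    + intros; apply ind_fun_nonneg.
    + intros t (z & <- & Hz)%in_map_iff _. now apply Hin.
  - rewrite <- (Rmult_1_r (INR (length l))), <- lsum_const, <- lsum_plus.
    apply lsum_le. intros; apply bonferroni.
Qed.

End Windows.

Lemma list_Z_bound (F : list Z) : exists G : nat, forall q, In q F -> (Z.abs q <= Z.of_nat G)%Z.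
Proof.
  induction F as [|q F [G HG]].
  - exists 0%nat. intros q [].
  - exists (Z.to_nat (Z.abs q) + G)%nat. intros q' [<-|H]; [lia|]. specialize (HG q' H). lia.
Qed.

(** The window of [window_count A m n], moved to the integers because differences may be
    negative. *)
Definition win (m n : nat) : list Z := zrange (Z.of_nat (m + 1)) (n + 1).

(** The cut-off to the window, all of whose entries are positive, makes the truncation in [Z.to_nat]
    harmless. *)
Definition win_ind (A : nat -> Prop) (m n : nat) (z : Z) : R :=
  indic (In z (win m n) /\ A (Z.to_nat z)).

Lemma lsum_win_ind A m n : lsum (win_ind A m n) (win m n) = window_count A m n.
Proof.
  unfold window_count. rewrite sum_f_R0_lsum. unfold win, zrange. rewrite lsum_map.
  apply lsum_ext. intros k Hk%in_seq. unfold win_ind.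
  replace (Z.to_nat (Z.of_nat (m + 1) + Z.of_nat k)) with (m + 1 + k)%nat by lia.
  f_equal. apply propositional_extensionality. split; [tauto|]. intros HA.
  split; [|assumption]. apply in_zrange. lia.
Qed.

Lemma win_ind_01 A m n z : win_ind A m n z = 0 \/ win_ind A m n z = 1.
Proof. apply indic_01. Qed.

Lemma win_ind_support A m n z : win_ind A m n z <> 0 -> In z (win m n) /\ A (Z.to_nat z).
Proof.
  intros H. apply NNPP; intros Hn. apply H. now apply indic_false.
Qed.

Definition wcorr (A : nat -> Prop) (m n : nat) (k : Z) : R :=
  corr (win_ind A m n) (win m n) k.

(* The differences occurring with frequency [c] in long windows are syndetic: a maximal set [F]
   no two elements of which differ by such a frequent difference is finite by packing, and
   by maximality every [k] differs frequently from some [q] in [F]. *)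
Lemma frequent_differences (A : nat -> Prop) : Rbar_lt 0 (upper_Bd A) ->
  exists (F : list Z) (c : R), 0 < c /\
    forall ks : list Z, exists m n,
      forall k, In k ks -> c * INR (n + 1) <= lsum (fun q => wcorr A m n (k - q)) F.
Proof.
  intros (d & Hd & HA)%upper_Bd_pos_dense.
  (* The size that a sparse [F] cannot reach. In a window of length [L], packing would give
     [s d L <= 2 L + s^2 c L <= 3 L]. *)
  assert (exists s : nat, 3 < INR s * d) as (s & Hs).
  { destruct (INR_unbounded (3 / d)) as [s Hs]. exists s.
    apply (Rmult_lt_compat_r d) in Hs; [|assumption].
    unfold Rdiv in Hs. rewrite Rmult_assoc, Rinv_l in Hs by lra. lra. }
  assert (Hs0 : 0 < INR s) by nra.
  (* The first bound gives [s^2 c <= 1] for the packing; the second makes the difference [0]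
     frequent in every dense window. *)
  set (c := Rmin (/ (INR s * INR s)) d).
  assert (Hc : 0 < c).
  { apply Rmin_glb_lt; [|assumption]. apply Rinv_0_lt_compat; nra. }
  assert (Hcd : c <= d) by apply Rmin_r.
  assert (Hcs : INR s * INR s * c <= 1).
  { apply Rle_trans with (INR s * INR s * / (INR s * INR s)).
    - apply Rmult_le_compat_l; [nra | apply Rmin_l].
    - right. field. lra. }
  set (dense := fun m n => d * INR (n + 1) <= window_count A m n).
  set (sparse := fun F m n =>
    forall k q, In k F -> In q F -> k <> q -> wcorr A m n (k - q) <= c * INR (n + 1)).
  (* Arbitrarily long windows are required so that the spread of [F] becomes negligible against the
     window. *)
  set (adm := fun F => NoDup F /\
    forall n0, exists n m, (n0 <= n)%nat /\ dense m n /\ sparse F m n).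
  assert (Hsize : forall F, adm F -> length F <> s).
  { intros F [HF Hadm] Hlen. destruct (list_Z_bound F) as [G HG].
    (* With [2 G <= n], enlarging the window by [G] on both sides at most doubles its length. *)
    destruct (Hadm (2 * G)%nat) as (n & m & Hn & Hdense & Hsp).
    assert (HL : 0 < INR (n + 1)) by (apply lt_0_INR; lia).
    assert (K := packing_bound (win_ind A m n) (win m n) (win_ind_01 A m n)
      (NoDup_zrange _ _) (fun z Hz => proj1 (win_ind_support A m n z Hz))
      (zrange (Z.of_nat (m + 1) - Z.of_nat G) (n + 1 + 2 * G)) F (c * INR (n + 1))
      (NoDup_zrange _ _) HF).
    rewrite lsum_win_ind, length_zrange, Hlen in K.
    assert (H1 : INR s * window_count A m n
                 <= INR (n + 1 + 2 * G) + INR s * INR s * (c * INR (n + 1))).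
    { apply K; [nra | | exact Hsp]. intros k z Hk Hz. specialize (HG k Hk).
      apply in_zrange in Hz. apply in_zrange. lia. }
    assert (H2 : INR (n + 1 + 2 * G) <= 2 * INR (n + 1)).
    { replace 2 with (INR 2) by reflexivity. rewrite <- mult_INR. apply le_INR. lia. }
    unfold dense in Hdense. nra. }
  (* Elements are added as long as possible; [r] is the room left before the forbidden size [s]. *)
  assert (Hmax : forall r F, adm F -> (length F + r = s)%nat ->
    exists F', adm F' /\ forall k, ~ In k F' -> ~ adm (k :: F')).
  { induction r as [|r IH]; intros F HF Hr.
    - exfalso. apply (Hsize F HF). lia.
    - destruct (classic (exists k, ~ In k F /\ adm (k :: F))) as [(k & _ & Hk)|Hno].
      + apply (IH (k :: F) Hk). simpl. lia.
      + exists F. split; [assumption|]. intros k Hk Hadm. apply Hno. now exists k. }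
  destruct (Hmax s nil) as (F & [HF Hadm] & HFmax).
  { split; [constructor|]. intros n0. destruct (HA n0) as (n & m & Hn & Hnm).
    exists n, m. split; [assumption|]. split; [assumption|]. intros k q []. }
  { reflexivity. }
  exists F, c. split; [assumption|].
  (* For [k] in [F] the difference with itself is frequent. Otherwise [k :: F] is not admissible,
     and the length beyond which it fails is the threshold. *)
  assert (Hk : forall k, exists n0, forall n m, (n0 <= n)%nat -> dense m n -> sparse F m n ->
    exists q, In q F /\ c * INR (n + 1) <= wcorr A m n (k - q)).
  { intros k. destruct (classic (In k F)) as [Hin|Hin].
    - exists 0%nat. intros n m _ Hdense _. exists k. split; [assumption|].
      rewrite Z.sub_diag. unfold wcorr. rewrite corr_0 by apply win_ind_01.
      rewrite lsum_win_ind. unfold dense in Hdense.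
      assert (0 < INR (n + 1)) by (apply lt_0_INR; lia). nra.
    - specialize (HFmax k Hin). apply NNPP; intros Hno. apply HFmax.
      split; [now constructor|]. intros n0. apply NNPP; intros Hno'.
      apply Hno. exists n0. intros n m Hn Hdense Hsp. apply NNPP; intros Hno''.
      apply Hno'. exists n, m. split; [assumption|]. split; [assumption|].
      assert (Hlt : forall q, In q F -> wcorr A m n (k - q) <= c * INR (n + 1)).
      { intros q Hq. apply Rnot_lt_le; intros Hlt. apply Hno''. exists q.
        split; [assumption | lra]. }
      intros k1 k2 [<-|H1] [<-|H2] Hne; [congruence | now apply Hlt | | now apply Hsp].
      replace (k1 - k)%Z with (- (k - k1))%Z by lia.
      eapply Rle_trans; [apply corr_sym|now apply Hlt].
      + apply win_ind_01.
      + apply NoDup_zrange.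
      + intros z Hz. now apply win_ind_support in Hz. }
  intros ks.
  (* Finitely many [k] share a threshold, so a single window serves the whole list. *)
  assert (exists n0, forall n m, (n0 <= n)%nat -> dense m n -> sparse F m n ->
    forall k, In k ks -> exists q, In q F /\ c * INR (n + 1) <= wcorr A m n (k - q)) as [n0 Hn0].
  { induction ks as [|k ks [n0 IH]].
    - exists 0%nat. intros n m _ _ _ k [].
    - destruct (Hk k) as [n1 H1]. exists (n0 + n1)%nat.
      intros n m Hn Hdense Hsp k' [<-|Hin].
      + apply H1; [lia | assumption | assumption].
      + apply IH; [lia | assumption | assumption | assumption]. }
  destruct (Hadm n0) as (n & m & Hn & Hdense & Hsp). exists m, n. intros k Hin.
  destruct (Hn0 n m Hn Hdense Hsp k Hin) as (q & Hq & Hle).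
  eapply Rle_trans; [exact Hle|].
  (* Bounding by the sum over [F] avoids having to select a [q] for each [k]. *)
  apply (lsum_ge_term (fun q => wcorr A m n (k - q))); [|assumption].
  intros y _. apply corr_nonneg, win_ind_01.
Qed.

(** * Weighted pseudo-shifts *)

Lemma iter_inj {I : Type} (f : I -> I) : (forall i k, f i = f k -> i = k) ->
  forall n i k, Nat.iter n f i = Nat.iter n f k -> i = k.
Proof.
  intros Hf n. induction n as [|n IH]; intros i k H; [assumption|].
  apply IH, Hf. exact H.
Qed.

(** The product of [w] over [f i], ..., [f^n i], which is the multiplier of the n-th iterate at
    coordinate [i]. *)
Fixpoint weight_prod {I : Type} (f : I -> I) (w : I -> C) (n : nat) (i : I) : C :=
  match n with
  | O => RtoC 1
  | S n' => Cmult (w (f i)) (weight_prod f w n' (f i))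
  end.

Section PseudoShift.
Context {I : Type} (p : R) (Hp : 1 < p) (f : I -> I) (w : I -> C) (M : R).
Context (Hf : forall i k, f i = f k -> i = k).
Context (HM : 1 <= M) (HwM : forall i, Cmod (w i) <= M) (Hw0 : forall i, w i <> RtoC 0).

Local Notation T := (pseudo_shift f w).
Local Notation W := (weight_prod f w).

Lemma iter_shift n x i : Nat.iter n T x i = Cmult (W n i) (x (Nat.iter n f i)).
Proof.
  revert i. induction n as [|n IH]; intros i.
  - simpl. ring.
  - rewrite Nat.iter_succ_r with (f := f).
    change (Nat.iter (S n) T x i) with (Cmult (w (f i)) (Nat.iter n T x (f i))).
    rewrite IH. simpl. ring.
Qed.

Lemma weight_prod_add m n i : W (m + n) i = Cmult (W m i) (W n (Nat.iter m f i)).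
Proof.
  revert i. induction m as [|m IH]; intros i.
  - simpl. ring.
  - rewrite Nat.iter_succ_r. simpl. rewrite IH. ring.
Qed.

Lemma weight_prod_neq0 n i : W n i <> RtoC 0.
Proof.
  revert i. induction n as [|n IH]; intros i; simpl.
  - intros H. apply (f_equal fst) in H. simpl in H. lra.
  - now apply Cmult_neq_0.
Qed.

Lemma weight_prod_le n i : Cmod (W n i) <= M ^ n.
Proof.
  revert i. induction n as [|n IH]; intros i; simpl.
  - rewrite Cmod_1; lra.
  - rewrite Cmod_mult. apply Rmult_le_compat; auto using Cmod_ge_0.
Qed.

(** Injectivity of [f^n] keeps the reindexed list free of repetitions, so only the weights can
    increase the norm. *)
Lemma norm_le_iter_shift n x r : norm_le p x r -> norm_le p (Nat.iter n T x) (M ^ n * r).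
Proof.
  intros [Hr Hx].
  apply norm_le_dom with (fun i => x (Nat.iter n f i)); [assumption | apply pow_le; lra | |].
  - intros i. rewrite iter_shift, Cmod_mult.
    apply Rmult_le_compat_r; [apply Cmod_ge_0 | apply weight_prod_le].
  - split; [assumption|]. rewrite lp_boundE. intros l Hl.
    rewrite <- lsum_map with (h := Nat.iter n f) (g := fun i => rpow (Cmod (x i)) p).
    apply Hx. apply NoDup_map_NoDup_ForallPairs; [|assumption].
    intros i k _ _. now apply iter_inj.
Qed.

Lemma in_lp_iter_shift n x : in_lp p x -> in_lp p (Nat.iter n T x).
Proof.
  rewrite !in_lp_norm by assumption. intros [r Hr]. exists (M ^ n * r).
  now apply norm_le_iter_shift.
Qed.

Lemma lp_dist_iter_shift n x y e :
  lp_dist_lt p x y e -> lp_dist_lt p (Nat.iter n T x) (Nat.iter n T y) (M ^ n * e).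
Proof.
  rewrite !lp_dist_norm by assumption. intros (r & Hr & Hn). exists (M ^ n * r). split.
  - apply Rmult_lt_compat_l; [apply pow_lt; lra | assumption].
  - eapply norm_le_dom1; [assumption| |exact (norm_le_iter_shift n _ _ Hn)].
    intros i. right. apply f_equal. rewrite !iter_shift. ring.
Qed.

(* Each coordinate along a cycle of [f] obeys a scalar linear recursion, which is either
   bounded or bounded away from zero outside zero, hence is not dense. *)
Lemma dense_orbit_aperiodic x :
  (forall U, X_open p U -> (exists u, U u) -> exists n, U (Nat.iter n T x)) ->
  forall d j, (0 < d)%nat -> Nat.iter d f j <> j.
Proof.
  intros Hx d j Hd Hj. set (phi := fun n => Nat.iter n T x j).
  assert (Hdense : forall (c e : R), 0 < e -> exists n, Cmod (Cminus (RtoC c) (phi n)) < e).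
  { intros c e He.
    set (v := fun i => Cmult (RtoC c) (unit_vec j i)).
    assert (Hv : in_lp p v) by (apply in_lp_scal, in_lp_unit_vec; assumption).
    destruct (Hx _ (X_open_ball p Hp v e)) as (n & _ & Hn).
    - exists v. split; [assumption | now apply lp_dist_refl].
    - exists n. apply (lp_dist_coord p Hp _ _ _ j) in Hn. unfold v, unit_vec in Hn.
      rewrite restr_in in Hn by reflexivity. rewrite Cmult_1_r in Hn. exact Hn. }
  (* The product of the weights around the cycle: [d] further steps multiply the coordinate by
     it. *)
  set (lam := W d j).
  assert (Hrec : forall n, phi (n + d)%nat = Cmult lam (phi n)).
  { intros n. unfold phi. rewrite Nat.add_comm, Nat.iter_add, iter_shift, Hj. reflexivity. }
  assert (Hmod : forall n, exists r, (r < d)%nat /\ exists q, phi n = Cmult (Cpow lam q) (phi r)).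
  { intros n. induction n as [n IH] using lt_wf_ind.
    destruct (Nat.lt_ge_cases n d) as [H|H].
    - exists n. split; [assumption|]. exists 0%nat. simpl. ring.
    - destruct (IH (n - d)%nat ltac:(lia)) as (r & Hr & q & Hq).
      exists r. split; [assumption|]. exists (S q).
      replace n with (n - d + d)%nat by lia. rewrite Hrec, Hq. simpl. ring. }
  destruct (Rle_dec (Cmod lam) 1) as [Hl|Hl].
  - assert (exists B, forall r, (r < d)%nat -> Cmod (phi r) <= B) as [B HB].
    { clear. induction d as [|d [B HB]].
      - exists 0. intros r Hr; lia.
      - exists (Rmax B (Cmod (phi d))). intros r Hr.
        destruct (Nat.eq_dec r d) as [->|]; [apply Rmax_r|].
        eapply Rle_trans; [apply HB; lia | apply Rmax_l]. }
    (* A target at distance at least [1] from the disc of radius [B]. *)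
    destruct (Hdense (Rabs B + 1) 1) as (n & Hn); [lra|].
    destruct (Hmod n) as (r & Hr & q & Hq).
    assert (H1 : Cmod (phi n) <= B).
    { rewrite Hq, Cmod_mult, Cmod_pow. assert (H := HB r Hr).
      assert (H' := Cmod_ge_0 (phi r)). assert (Cmod lam ^ q <= 1).
      { rewrite <- (pow1 q). apply pow_incr. split; [apply Cmod_ge_0 | assumption]. }
      assert (0 <= Cmod lam ^ q) by (apply pow_le, Cmod_ge_0). nra. }
    assert (H2 := Cmod_triangle (Cminus (RtoC (Rabs B + 1)) (phi n)) (phi n)).
    replace (Cplus (Cminus (RtoC (Rabs B + 1)) (phi n)) (phi n)) with (RtoC (Rabs B + 1)) in H2
      by ring.
    rewrite Cmod_R in H2. assert (H3 := Rle_abs B). assert (H4 := Rabs_pos B).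
    rewrite (Rabs_right (Rabs B + 1)) in H2 by lra. lra.
  - assert (exists e, 0 < e /\ forall r, (r < d)%nat -> phi r = RtoC 0 \/ e <= Cmod (phi r))
      as (e & He & HB).
    { clear. induction d as [|d (e & He & HB)].
      - exists 1. split; [lra|]. intros r Hr; lia.
      - destruct (classic (phi d = RtoC 0)) as [E|E].
        + exists e. split; [assumption|]. intros r Hr.
          destruct (Nat.eq_dec r d) as [->|]; [now left|]. apply HB; lia.
        + exists (Rmin e (Cmod (phi d))). split.
          * apply Rmin_glb_lt; [assumption | now apply Cmod_gt_0].
          * intros r Hr. destruct (Nat.eq_dec r d) as [->|]; [right; apply Rmin_r|].
            destruct (HB r ltac:(lia)) as [H|H]; [now left|].
            right. eapply Rle_trans; [apply Rmin_l | exact H]. }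
    (* The open disc of radius [e/2] about [e/2] contains neither [0] nor any point of modulus at
       least [e]. *)
    destruct (Hdense (e / 2) (e / 2)) as (n & Hn); [lra|].
    destruct (Hmod n) as (r & Hr & q & Hq).
    destruct (HB r Hr) as [E|E].
    + rewrite Hq, E, Cmult_0_r in Hn.
      replace (Cminus (RtoC (e / 2)) (RtoC 0)) with (RtoC (e / 2)) in Hn by ring.
      rewrite Cmod_R, Rabs_right in Hn; lra.
    + assert (H1 : e <= Cmod (phi n)).
      { rewrite Hq, Cmod_mult, Cmod_pow.
        assert (1 <= Cmod lam ^ q) by (apply pow_R1_Rle; lra). nra. }
      assert (H2 := Cmod_triangle (Copp (Cminus (RtoC (e / 2)) (phi n))) (RtoC (e / 2))).
      replace (Cplus (Copp (Cminus (RtoC (e / 2)) (phi n))) (RtoC (e / 2))) with (phi n) in H2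
        by ring.
      rewrite Cmod_opp, Cmod_R, (Rabs_right (e / 2)) in H2 by lra. lra.
Qed.

(** * The formal fixed vector on an orbit *)

(* [a] is the formal [T]-fixed vector supported on the [f]-orbit of [j] with [a j = 1],
   and [lev i] is the signed position of [i] on that orbit. *)
Definition fixed_vec_data (j : I) (a : I -> C) (lev : I -> Z) : Prop :=
  (forall i m n, Nat.iter m f i = Nat.iter n f j ->
     Cmult (a i) (W n j) = W m i /\ lev i = (Z.of_nat n - Z.of_nat m)%Z) /\
  (forall i, (forall m n, Nat.iter m f i <> Nat.iter n f j) -> a i = RtoC 0).

Lemma iter_meet_shift i j m n k :
  Nat.iter m f i = Nat.iter n f j -> Nat.iter (k + m) f i = Nat.iter (k + n) f j.
Proof. intros H. now rewrite !Nat.iter_add, H. Qed.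

(** Two meetings of the orbits of [i] and [j] give the same signed position: otherwise injectivity
    would turn the coincidence of two iterates of [j] into a cycle through [j]. *)
Lemma iter_meet_level j i m n m' n' :
  (forall d, (0 < d)%nat -> Nat.iter d f j <> j) ->
  Nat.iter m f i = Nat.iter n f j -> Nat.iter m' f i = Nat.iter n' f j ->
  (m' + n = m + n')%nat.
Proof.
  intros Hj H H'.
  assert (E : Nat.iter (m' + n) f j = Nat.iter (m + n') f j).
  { rewrite <- (iter_meet_shift _ _ _ _ m' H), <- (iter_meet_shift _ _ _ _ m H').
    f_equal. lia. }
  destruct (Nat.lt_trichotomy (m' + n) (m + n')) as [Hlt|[Heq|Hlt]]; [|assumption|]; exfalso.
  - apply (Hj (m + n' - (m' + n))%nat); [lia|]. symmetry.
    apply (iter_inj f Hf (m' + n)). rewrite <- Nat.iter_add, E. f_equal. lia.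
  - apply (Hj (m' + n - (m + n'))%nat); [lia|]. symmetry.
    apply (iter_inj f Hf (m + n')). rewrite <- Nat.iter_add, <- E. f_equal. lia.
Qed.

(** One meeting defines [a i] as [W m i / W n j]. Another gives the same quotient: prolong both
    meetings to a common one and split the weight products by [weight_prod_add]. *)
Lemma fixed_vec_exists j : (forall d, (0 < d)%nat -> Nat.iter d f j <> j) ->
  exists a lev, fixed_vec_data j a lev.
Proof.
  intros Hj.
  assert (K : forall i, exists v : C * Z,
    (forall m n, Nat.iter m f i = Nat.iter n f j ->
       Cmult (fst v) (W n j) = W m i /\ snd v = (Z.of_nat n - Z.of_nat m)%Z) /\
    ((forall m n, Nat.iter m f i <> Nat.iter n f j) -> fst v = RtoC 0)).
  { intros i. destruct (classic (exists m n, Nat.iter m f i = Nat.iter n f j))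
      as [(m & n & H)|Hno].
    - exists (Cdiv (W m i) (W n j), (Z.of_nat n - Z.of_nat m)%Z). simpl. split.
      + intros m' n' H'. assert (E := iter_meet_level _ _ _ _ _ _ Hj H H').
        split; [|lia].
        assert (E1 := weight_prod_add m m' i). assert (E2 := weight_prod_add m' m i).
        assert (E3 := weight_prod_add n m' j). assert (E4 := weight_prod_add n' m j).
        rewrite H in E1. rewrite H' in E2.
        replace (m' + m)%nat with (m + m')%nat in E2 by lia.
        replace (n' + m)%nat with (n + m')%nat in E4 by lia.
        rewrite E1 in E2. rewrite E3 in E4.
        assert (N1 := weight_prod_neq0 n j). assert (N2 := weight_prod_neq0 m' (Nat.iter n f j)).
        assert (N3 := weight_prod_neq0 m (Nat.iter n' f j)).
        assert (N4 := weight_prod_neq0 n' j).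
        set (P := W m' (Nat.iter n f j)) in *. set (Q := W m (Nat.iter n' f j)) in *.
        set (X := W m i) in *. set (Y := W n j) in *.
        set (X' := W m' i) in *. set (Y' := W n' j) in *.
        assert (EX : X = Cdiv (Cmult X' Q) P) by (rewrite <- E2; field; assumption).
        assert (EY : Y' = Cdiv (Cmult Y P) Q) by (rewrite E4; field; assumption).
        rewrite EX, EY. field. repeat split; assumption.
      + intros Hno. exfalso. exact (Hno m n H).
    - exists (RtoC 0, 0%Z). split; [|reflexivity].
      intros m n H. exfalso. apply Hno. now exists m, n. }
  set (v := fun i => proj1_sig (constructive_indefinite_description _ (K i))).
  assert (Hv := fun i => proj2_sig (constructive_indefinite_description _ (K i))).
  exists (fun i => fst (v i)), (fun i => snd (v i)). split.
  - intros i. exact (proj1 (Hv i)).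
  - intros i. exact (proj2 (Hv i)).
Qed.

Section FixedVec.
Context (j : I) (a : I -> C) (lev : I -> Z) (Ha : fixed_vec_data j a lev).

Lemma fixed_vec_base : a j = RtoC 1 /\ lev j = 0%Z.
Proof.
  destruct (proj1 Ha j 0%nat 0%nat eq_refl) as [H1 H2]. split; [|exact H2].
  simpl in H1. rewrite Cmult_1_r in H1. exact H1.
Qed.

Lemma fixed_vec_support i : a i <> RtoC 0 -> exists m n, Nat.iter m f i = Nat.iter n f j.
Proof.
  intros H. apply NNPP; intros Hno. apply H, (proj2 Ha). intros m n E.
  apply Hno. now exists m, n.
Qed.

(** The equation [T^s a = a], read at coordinate [i]. *)
Lemma fixed_vec_step s i : a i = Cmult (W s i) (a (Nat.iter s f i)).
Proof.
  destruct (classic (exists m n, Nat.iter m f i = Nat.iter n f j)) as [(m & n & H)|Hno].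
  - destruct (proj1 Ha i (m + s) (n + s))%nat as [E _].
    { rewrite (Nat.add_comm m), (Nat.add_comm n). now apply iter_meet_shift. }
    destruct (proj1 Ha (Nat.iter s f i) m (n + s))%nat as [E' _].
    { rewrite <- Nat.iter_add, (Nat.add_comm m), (Nat.add_comm n). now apply iter_meet_shift. }
    rewrite (Nat.add_comm m s), (weight_prod_add s m i), <- E' in E.
    assert (N := weight_prod_neq0 (n + s) j).
    transitivity (Cdiv (Cmult (a i) (W (n + s) j)) (W (n + s) j)); [field; assumption|].
    rewrite E. field. assumption.
  - rewrite (proj2 Ha i), (proj2 Ha (Nat.iter s f i)); [ring| |].
    + intros m n E. apply Hno. exists (m + s)%nat, n. now rewrite Nat.iter_add.
    + intros m n E. apply Hno. now exists m, n.
Qed.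

Lemma lev_step s i : a i <> RtoC 0 -> lev (Nat.iter s f i) = (lev i + Z.of_nat s)%Z.
Proof.
  intros (m & n & H)%fixed_vec_support.
  destruct (proj1 Ha _ _ _ H) as [_ E].
  destruct (proj1 Ha (Nat.iter s f i) m (s + n))%nat as [_ E'].
  { rewrite <- Nat.iter_add, (Nat.add_comm m). now apply iter_meet_shift. }
  lia.
Qed.

(** The position determines the point on the orbit, after cancelling [f^m] by injectivity. *)
Lemma lev_meet u n i : a i <> RtoC 0 -> (Z.of_nat u + lev i)%Z = Z.of_nat n ->
  Nat.iter u f i = Nat.iter n f j.
Proof.
  intros (m & k & H)%fixed_vec_support Hlev.
  destruct (proj1 Ha _ _ _ H) as [_ E].
  apply (iter_inj f Hf m). rewrite <- !Nat.iter_add, Nat.add_comm, Nat.iter_add, H.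
  rewrite <- Nat.iter_add. f_equal. lia.
Qed.

Lemma fixed_vec_le s i : Cmod (a i) <= M ^ s * Cmod (a (Nat.iter s f i)).
Proof.
  rewrite (fixed_vec_step s i), Cmod_mult.
  apply Rmult_le_compat_r; [apply Cmod_ge_0 | apply weight_prod_le].
Qed.

(** * Summability of the fixed vector *)

Local Notation visits x := (fun n => in_lp p (Nat.iter n T x)
                                  /\ lp_dist_lt p (unit_vec j) (Nat.iter n T x) (/ 2)).

Lemma visits_ge x n : visits x n -> / 2 <= Cmod (Nat.iter n T x j).
Proof.
  intros [_ H]. apply (lp_dist_coord p Hp _ _ _ j) in H. unfold unit_vec in H.
  rewrite restr_in in H by reflexivity.
  assert (K := Cmod_triangle (Cminus (RtoC 1) (Nat.iter n T x j)) (Nat.iter n T x j)).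
  replace (Cplus (Cminus (RtoC 1) (Nat.iter n T x j)) (Nat.iter n T x j)) with (RtoC 1) in K
    by ring.
  rewrite Cmod_1 in K. lra.
Qed.

Lemma visits_norm x n : visits x n -> norm_le p (Nat.iter n T x) (3 / 2).
Proof.
  intros [_ (r & Hr & H)%lp_dist_norm]; [|assumption].
  apply norm_le_weaken with (r + 1); [assumption| |lra].
  assert (H' : norm_le p (fun i => Copp (Cminus (unit_vec j i) (Nat.iter n T x i))) r).
  { eapply norm_le_dom1; [assumption| |exact H]. intros i. rewrite Cmod_opp. lra. }
  eapply norm_le_dom1; [assumption| |].
  2:{ apply norm_le_add; [assumption | exact H' | apply (norm_le_unit_vec p Hp j)]. }
  intros i. right. apply f_equal. simpl. ring.
Qed.

(** If [u] and [v = u + lev i] are visits, then [f^u i = f^v j], so coordinate [i] of [T^u x] is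
    [a i] times coordinate [j] of [T^v x], whose modulus is at least [1/2]. Since [T^u x] has norm
    at most [3/2], each [u] contributes at most [3^p]. *)
Lemma window_fixed_vec_sum x m n l : NoDup l ->
  lsum (fun i => rpow (Cmod (a i)) p * wcorr (visits x) m n (lev i)) l
  <= rpow 3 p * INR (n + 1).
Proof.
  intros Hl. set (b := win_ind (visits x) m n).
  assert (Hb0 : forall z, 0 <= b z) by (intros; apply ind_fun_nonneg, win_ind_01).
  assert (H3 : 0 <= rpow 3 p) by apply rpow_nonneg.
  rewrite (lsum_ext _ (fun i => lsum (fun u =>
             rpow (Cmod (a i)) p * (b u * b (u + lev i)%Z)) (win m n)))
    by (intros; now rewrite lsum_scal).
  rewrite lsum_swap.
  apply Rle_trans with (lsum (fun _ => rpow 3 p) (win m n)).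
  2:{ rewrite lsum_const. unfold win. rewrite length_zrange. lra. }
  apply lsum_le. intros u Hu.
  rewrite (lsum_ext _ (fun i => b u * (rpow (Cmod (a i)) p * b (u + lev i)%Z)))
    by (intros; ring).
  rewrite lsum_scal.
  destruct (Req_dec (b u) 0) as [E|E]; [rewrite E; lra|].
  assert (Hu' := E). apply win_ind_support in Hu' as [_ Hvis].
  destruct (win_ind_01 (visits x) m n u) as [E'|E'];
    fold b in E'; [contradiction|]; rewrite E', Rmult_1_l.
  apply in_zrange in Hu.
  destruct (visits_norm _ _ Hvis) as [_ Hnorm].
  replace 3 with (2 * (3 / 2)) by lra. rewrite rpow_mult by lra.
  apply Rle_trans with
    (rpow 2 p * lsum (fun i => rpow (Cmod (Nat.iter (Z.to_nat u) T x i)) p) l).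
  2:{ apply Rmult_le_compat_l; [apply rpow_nonneg | now apply Hnorm]. }
  rewrite <- lsum_scal. apply lsum_le. intros i _.
  rewrite <- rpow_mult by (try apply Cmod_ge_0; lra).
  destruct (classic (a i = RtoC 0)) as [Ea|Ea].
  { rewrite Ea, Cmod_0, rpow_0, Rmult_0_l. apply rpow_nonneg. }
  destruct (win_ind_01 (visits x) m n (u + lev i)%Z) as [Eb|Eb]; fold b in Eb; rewrite Eb.
  { rewrite Rmult_0_r. apply rpow_nonneg. }
  rewrite Rmult_1_r. apply rpow_le; [lra|].
  assert (Hv : b (u + lev i)%Z <> 0) by lra.
  apply win_ind_support in Hv as [Hin Hv]. apply in_zrange in Hin.
  assert (Hmeet : Nat.iter (Z.to_nat u) f i = Nat.iter (Z.to_nat (u + lev i)) f j)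
    by (apply lev_meet; [assumption | lia]).
  destruct (proj1 Ha _ _ _ Hmeet) as [Ew _].
  apply visits_ge in Hv. rewrite iter_shift in Hv |- *.
  rewrite Hmeet, <- Ew. rewrite !Cmod_mult in *.
  assert (0 <= Cmod (a i)) by apply Cmod_ge_0. nra.
Qed.

(** Frequent differences have the form [lev i + G - q] with [q] in [F]. The point [f^(G - q) i] has
    this position, and moving there from [i] costs only a bounded factor, so [window_fixed_vec_sum]
    applies for each [q]. *)
Lemma fixed_vec_in_lp x : Rbar_lt 0 (upper_Bd (visits x)) -> in_lp p a.
Proof.
  intros Hd. destruct (frequent_differences _ Hd) as (F & c & Hc & HF).
  destruct (list_Z_bound F) as [G HG].
  (* The offset [G] makes every [G - q] a nonnegative number of steps, and at most [2 G] of them. *)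
  set (K := rpow (M ^ (2 * G)) p).
  exists (INR (length F) * (K * rpow 3 p) / c). rewrite lp_boundE. intros l Hl.
  destruct (HF (map (fun i => (lev i + Z.of_nat G)%Z) l)) as (m & n & Hmn).
  set (r := wcorr (visits x) m n) in Hmn.
  assert (Hr : forall k, 0 <= r k) by (intros; apply corr_nonneg, win_ind_01).
  assert (HL : 0 < INR (n + 1)) by (apply lt_0_INR; lia).
  set (h := fun i => rpow (Cmod (a i)) p).
  assert (Hmain : c * INR (n + 1) * lsum h l
                  <= INR (length F) * (K * (rpow 3 p * INR (n + 1)))).
  { rewrite <- lsum_scal.
    apply Rle_trans with
      (lsum (fun i => lsum (fun q => r (lev i + Z.of_nat G - q)%Z * h i) F) l).
    - apply lsum_le. intros i Hi.
      rewrite (lsum_ext _ (fun q => h i * r (lev i + Z.of_nat G - q)%Z)) by (intros; ring).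
      rewrite lsum_scal, Rmult_comm. apply Rmult_le_compat_l; [apply rpow_nonneg|].
      apply Hmn. now apply (in_map (fun i => (lev i + Z.of_nat G)%Z)).
    - rewrite lsum_swap, <- lsum_const. apply lsum_le. intros q Hq.
      specialize (HG q Hq). set (s := Z.to_nat (Z.of_nat G - q)).
      apply Rle_trans with
        (lsum (fun i => K * (h (Nat.iter s f i) * r (lev (Nat.iter s f i)))) l).
      + apply lsum_le. intros i _. destruct (classic (a i = RtoC 0)) as [Ea|Ea].
        * unfold h at 1. rewrite Ea, Cmod_0, rpow_0, Rmult_0_r.
          repeat apply Rmult_le_pos; [apply rpow_nonneg | apply rpow_nonneg | apply Hr].
        * rewrite (lev_step s i Ea).
          replace (lev i + Z.of_nat s)%Z with (lev i + Z.of_nat G - q)%Z by lia.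
          rewrite Rmult_comm, <- Rmult_assoc. apply Rmult_le_compat_r; [apply Hr|].
          unfold h, K. rewrite <- rpow_mult by (try apply Cmod_ge_0; apply pow_le; lra).
          apply rpow_le; [lra|]. eapply Rle_trans; [apply (fixed_vec_le s)|].
          apply Rmult_le_compat_r; [apply Cmod_ge_0|]. apply Rle_pow; [assumption | lia].
      + rewrite lsum_scal. apply Rmult_le_compat_l; [apply rpow_nonneg|].
        (* The points [f^s i] are distinct, so they form an admissible list for the window
           estimate. *)
        rewrite <- lsum_map with (g := fun i => h i * r (lev i)).
        apply window_fixed_vec_sum. apply NoDup_map_NoDup_ForallPairs; [|assumption].
        intros i k _ _. now apply iter_inj. }
  fold h. apply Rmult_le_reg_l with (c * INR (n + 1)); [nra|].
  eapply Rle_trans; [exact Hmain|]. right. field. lra.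
Qed.

(** [f^n] raises positions by [n], so it preserves divisibility by [n]; on the retained points the
    fixed-vector equation applies. *)
Lemma fixed_vec_section_periodic n :
  Nat.iter n T (restr (fun i => (Z.of_nat n | lev i)%Z) a)
  = restr (fun i => (Z.of_nat n | lev i)%Z) a.
Proof.
  apply functional_extensionality. intros i. rewrite iter_shift.
  destruct (classic (a i = RtoC 0)) as [E|E].
  - assert (E' : a (Nat.iter n f i) = RtoC 0).
    { rewrite (fixed_vec_step n) in E. apply NNPP; intros N.
      revert E. apply Cmult_neq_0; [apply weight_prod_neq0 | assumption]. }
    unfold restr. destruct excluded_middle_informative, excluded_middle_informative;
      rewrite ?E, ?E'; ring.
  - assert (L := lev_step n i E).
    destruct (classic (Z.of_nat n | lev i)%Z) as [D|D].
    + rewrite !restr_in; [symmetry; apply fixed_vec_step | assumption |].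
      rewrite L. apply Z.divide_add_r; [assumption | apply Z.divide_refl].
    + rewrite !restr_out; [ring | assumption |].
      rewrite L. intros D'. apply D.
      apply (Z.divide_add_cancel_r _ (Z.of_nat n)); [apply Z.divide_refl|].
      now rewrite Z.add_comm.
Qed.

End FixedVec.

(** * Approximation by periodic vectors *)

(** Asking for every large [n] lets sums, and later several operators, use one common period. *)
Definition periodic_approx (v : I -> C) : Prop :=
  forall e, 0 < e -> exists n0, forall n, (n0 <= n)%nat ->
    exists y, in_lp p y /\ lp_dist_lt p v y e /\ Nat.iter n T y = y.

Lemma periodic_approx_unit j a lev : fixed_vec_data j a lev -> in_lp p a ->
  periodic_approx (unit_vec j).
Proof.
  intros Ha Hlp e He.
  destruct (lp_tail p Hp a (e / 2) Hlp) as [l Hl]; [lra|].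
  destruct (list_Z_bound (map lev l)) as [G HG].
  (* Beyond [G], no nonzero position occurring in [l] is a multiple of [n]. *)
  exists (S G). intros n Hn. eexists. split; [|split].
  3: apply (fixed_vec_section_periodic j a lev Ha n).
  - eapply in_lp_dom; [assumption| |exact Hlp]. apply restr_dom.
  - apply lp_dist_norm; [assumption|]. exists (e / 2). split; [lra|].
    eapply norm_le_dom1; [assumption| |exact Hl]. intros i. simpl.
    destruct (fixed_vec_base j a lev Ha) as [Ej Lj].
    destruct (classic (i = j)) as [->|Hij].
    + unfold unit_vec. rewrite !restr_in by (rewrite ?Lj; auto using Z.divide_0_r).
      rewrite Ej. replace (Cminus (RtoC 1) (RtoC 1)) with (RtoC 0) by ring.
      rewrite Cmod_0. apply Cmod_ge_0.
    + unfold unit_vec. rewrite (restr_out (fun i => i = j)) by assumption.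
      replace (Cminus (RtoC 0) (restr (fun i => (Z.of_nat n | lev i)%Z) a i))
        with (Copp (restr (fun i => (Z.of_nat n | lev i)%Z) a i)) by ring.
      rewrite Cmod_opp.
      destruct (classic (In i l)) as [Hi|Hi].
      2:{ rewrite (restr_in (fun i => ~ In i l)) by assumption. apply restr_dom. }
      destruct (classic (a i = RtoC 0)) as [E|E].
      { eapply Rle_trans; [apply restr_dom|]. rewrite E, Cmod_0. apply Cmod_ge_0. }
      rewrite (restr_out (fun i => (Z.of_nat n | lev i)%Z)).
      { rewrite Cmod_0; apply Cmod_ge_0. }
      specialize (HG (lev i) (in_map lev _ _ Hi)).
      (* A retained point of [l] would have position [0], hence be [j] itself. *)
      intros D. assert (lev i = 0)%Z as L0.
      { apply NNPP; intros N. apply Z.divide_abs_r, Z.divide_pos_le in D; lia. }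
      apply Hij. apply (lev_meet j a lev Ha 0 0 i E). lia.
Qed.

Lemma periodic_approx_zero : periodic_approx (fun _ => RtoC 0).
Proof.
  intros e He. exists 0%nat. intros n _. exists (fun _ => RtoC 0).
  split; [now apply in_lp_zero|]. split; [now apply lp_dist_refl|].
  apply functional_extensionality. intros i. rewrite iter_shift. ring.
Qed.

Lemma periodic_approx_scal c v : periodic_approx v -> periodic_approx (fun i => Cmult c (v i)).
Proof.
  intros Hv e He. assert (Hc := Cmod_ge_0 c).
  (* The summand [1] covers the case [c = 0]. *)
  destruct (Hv (e / (Cmod c + 1))) as [n0 Hn0]; [apply Rdiv_lt_0_compat; lra|].
  exists n0. intros n Hn. destruct (Hn0 n Hn) as (y & Hy & Hd & Hper).
  exists (fun i => Cmult c (y i)). split; [now apply in_lp_scal|]. split.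
  - apply lp_dist_norm in Hd as (r & Hr & H); [|assumption].
    apply lp_dist_norm; [assumption|]. exists (Cmod c * r).
    assert (H0 := proj1 H). split.
    + apply (Rmult_lt_compat_r (Cmod c + 1)) in Hr; [|lra].
      unfold Rdiv in Hr. rewrite Rmult_assoc, Rinv_l in Hr by lra. nra.
    + eapply norm_le_dom; [assumption | assumption | | exact H].
      intros i. simpl. rewrite <- Cmod_mult. right. apply f_equal. ring.
  - apply functional_extensionality. intros i. rewrite iter_shift.
    assert (E := equal_f Hper i). rewrite iter_shift in E. rewrite <- E. ring.
Qed.

Lemma periodic_approx_add u v : periodic_approx u -> periodic_approx v ->
  periodic_approx (fun i => Cplus (u i) (v i)).
Proof.
  intros Hu Hv e He.
  destruct (Hu (e / 2)) as [n1 H1]; [lra|]. destruct (Hv (e / 2)) as [n2 H2]; [lra|].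
  exists (n1 + n2)%nat. intros n Hn.
  destruct (H1 n ltac:(lia)) as (y & Hy & Hyd & Hyp).
  destruct (H2 n ltac:(lia)) as (z & Hz & Hzd & Hzp).
  exists (fun i => Cplus (y i) (z i)). split; [now apply in_lp_add|]. split.
  - apply lp_dist_norm in Hyd as (r & Hr & Hny); [|assumption].
    apply lp_dist_norm in Hzd as (s & Hs & Hnz); [|assumption].
    apply lp_dist_norm; [assumption|]. exists (r + s). split; [lra|].
    eapply norm_le_dom1; [assumption| |exact (norm_le_add p Hp _ _ _ _ Hny Hnz)].
    intros i. right. apply f_equal. simpl. ring.
  - apply functional_extensionality. intros i. rewrite iter_shift.
    assert (Ey := equal_f Hyp i). assert (Ez := equal_f Hzp i).
    rewrite iter_shift in Ey, Ez. rewrite <- Ey, <- Ez. ring.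
Qed.

(** Truncation to a finite list leaves a linear combination of unit vectors, to which the closure
    under sums and multiples applies. *)
Lemma periodic_approx_all : (forall j, periodic_approx (unit_vec j)) ->
  forall u, in_lp p u -> periodic_approx u.
Proof.
  intros Hunit u Hu e He.
  destruct (lp_tail p Hp u (e / 3) Hu) as [l Hl]; [lra|].
  assert (Hfin : periodic_approx (restr (fun i => In i l) u)).
  { clear Hl. induction l as [|j l IH].
    - replace (restr (fun i => In i nil) u) with (fun _ : I => RtoC 0).
      + apply periodic_approx_zero.
      + apply functional_extensionality. intros i. symmetry. now apply restr_out.
    (* The list from [lp_tail] may repeat entries; a repeated [j] leaves the restriction
       unchanged. *)
    - destruct (classic (In j l)) as [Hj|Hj].
      + replace (restr (fun i => In i (j :: l)) u) with (restr (fun i => In i l) u); [assumption|].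
        f_equal. apply functional_extensionality. intros i.
        apply propositional_extensionality. simpl. split; [tauto|]. intros [<-|H]; assumption.
      + replace (restr (fun i => In i (j :: l)) u)
          with (fun i => Cplus (Cmult (u j) (unit_vec j i)) (restr (fun i => In i l) u i)).
        * apply periodic_approx_add; [now apply periodic_approx_scal | assumption].
        * apply functional_extensionality. intros i. unfold unit_vec.
          destruct (classic (i = j)) as [->|Hij].
          -- rewrite (restr_in (fun i => i = j)) by reflexivity.
             rewrite (restr_out (fun i => In i l)) by assumption.
             rewrite restr_in by now left. ring.
          -- rewrite (restr_out (fun i => i = j)) by assumption.
             destruct (classic (In i l)) as [Hi|Hi].
             ++ rewrite !restr_in by (try right; assumption). ring.
             ++ rewrite !restr_out; [ring | | assumption].
                intros [<-|H]; [now apply Hij | now apply Hi]. }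
  destruct (Hfin (e / 2)) as [n0 Hn0]; [lra|].
  exists n0. intros n Hn. destruct (Hn0 n Hn) as (y & Hy & Hd & Hper).
  exists y. split; [assumption|]. split; [|assumption].
  replace e with (e / 2 + e / 2) by lra.
  apply lp_dist_triangle with (restr (fun i => In i l) u); [assumption| |assumption].
  apply lp_dist_norm; [assumption|]. exists (e / 3). split; [lra|].
  eapply norm_le_dom1; [assumption| |exact Hl].
  intros i. right. apply f_equal. destruct (classic (In i l)) as [Hi|Hi].
  - rewrite (restr_in (fun i => In i l)) by assumption.
    rewrite restr_out by tauto. ring.
  - rewrite (restr_out (fun i => In i l)) by assumption.
    rewrite restr_in by assumption. ring.
Qed.

(** The same [x] serves twice: its dense orbit excludes cycles, so the fixed vector exists, and its
    visits near [unit_vec j] make that vector summable. *)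
Lemma reit_hypercyclic_periodic_approx :
  reit_hypercyclic p T -> forall u, in_lp p u -> periodic_approx u.
Proof.
  intros (x & Hx & Hvis). apply periodic_approx_all. intros j.
  assert (Hj : forall d, (0 < d)%nat -> Nat.iter d f j <> j).
  { intros d Hd. apply (dense_orbit_aperiodic x); [|assumption].
    intros U HU HU0. now apply upper_Bd_pos_nonempty, Hvis. }
  destruct (fixed_vec_exists j Hj) as (a & lev & Ha).
  apply (periodic_approx_unit j a lev Ha).
  apply (fixed_vec_in_lp j a lev Ha x).
  apply (Hvis _ (X_open_ball p Hp (unit_vec j) (/ 2))).
  exists (unit_vec j). split; [now apply in_lp_unit_vec | apply lp_dist_refl; [assumption | lra]].
Qed.
End PseudoShift.

(** * Disjoint reiterative hypercyclicity *)

Lemma uniform_bound (P : nat -> nat -> Prop) N :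
  (forall i a b, (a <= b)%nat -> P i a -> P i b) ->
  (forall i, (1 <= i <= N)%nat -> exists a, P i a) ->
  exists a, forall i, (1 <= i <= N)%nat -> P i a.
Proof.
  intros Hmono. induction N as [|N IH]; intros H.
  - exists 0%nat. intros i Hi; lia.
  - destruct IH as [a Ha]; [intros i Hi; apply H; lia|].
    destruct (H (S N)) as [b Hb]; [lia|].
    exists (a + b)%nat. intros i Hi. destruct (Nat.eq_dec i (S N)) as [->|Hne].
    + apply Hmono with b; [lia | assumption].
    + apply Hmono with a; [lia | apply Ha; lia].
Qed.

Section Disjoint.
Context {I : Type} (p : R) (Hp : 1 < p) (N : nat) (f : nat -> I -> I) (w : nat -> I -> C).
Context (Hf : forall i, (1 <= i <= N)%nat -> forall j k, f i j = f i k -> j = k).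
Context (Hw : forall i, (1 <= i <= N)%nat -> bounded_nonzero_weight (w i)).

Local Notation T := (fun i => pseudo_shift (f i) (w i)).
Local Notation in_lpN u := (forall i, (1 <= i <= N)%nat -> in_lp p (u i)).

Lemma common_weight_bound : exists M, 1 <= M /\
  forall i, (1 <= i <= N)%nat -> forall j, Cmod (w i j) <= M.
Proof.
  destruct (uniform_bound (fun i a => forall j, Cmod (w i j) <= INR a) N) as [a Ha].
  - intros i a b Hab H j. apply Rle_trans with (INR a); [apply H | now apply le_INR].
  - intros i Hi. destruct (Hw i Hi) as [[B HB] _].
    destruct (INR_unbounded B) as [a Ha]. exists a. intros j. specialize (HB j). lra.
  - exists (INR (S a)). rewrite S_INR. assert (H := pos_INR a). split; [lra|].
    intros i Hi j. specialize (Ha i Hi j). lra.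
Qed.

Lemma in_lp_iter i n x : (1 <= i <= N)%nat -> in_lp p x -> in_lp p (Nat.iter n (T i) x).
Proof.
  intros Hi. destruct common_weight_bound as (M & HM & HwM).
  exact (in_lp_iter_shift p Hp (f i) (w i) M (Hf i Hi) HM (HwM i Hi) n x).
Qed.

Lemma lp_dist_weaken (x y : I -> C) e e' :
  lp_dist_lt p x y e -> e <= e' -> lp_dist_lt p x y e'.
Proof.
  rewrite !lp_dist_norm by assumption. intros (r & Hr & H) He. exists r. split; [lra | assumption].
Qed.

Lemma XN_open_iff (U V : (nat -> I -> C) -> Prop) :
  XN_open p N U -> (forall u, U u <-> V u) -> XN_open p N V.
Proof.
  intros HU H. replace V with U; [assumption|].
  apply functional_extensionality. intros u. apply propositional_extensionality, H.
Qed.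

Lemma XN_open_inter U V : XN_open p N U -> XN_open p N V ->
  XN_open p N (fun u : nat -> I -> C => U u /\ V u).
Proof.
  intros [HU1 HU2] [HV1 HV2]. split.
  - intros u [Hu _]. now apply HU1.
  - intros u [Hu Hv]. destruct (HU2 u Hu) as (e1 & He1 & H1).
    destruct (HV2 u Hv) as (e2 & He2 & H2).
    exists (Rmin e1 e2). split; [now apply Rmin_glb_lt|].
    intros v Hlp Hd. split.
    + apply H1; [assumption|]. intros i Hi.
      eapply lp_dist_weaken; [now apply Hd | apply Rmin_l].
    + apply H2; [assumption|]. intros i Hi.
      eapply lp_dist_weaken; [now apply Hd | apply Rmin_r].
Qed.

Lemma XN_open_preimage U n : XN_open p N U ->
  XN_open p N (fun u => in_lpN u /\ U (fun i => Nat.iter n (T i) (u i))).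
Proof.
  intros [HU1 HU2]. split; [tauto|]. intros u [Hu HUu].
  destruct common_weight_bound as (M & HM & HwM).
  destruct (HU2 _ HUu) as (e & He & H).
  assert (HMn : 0 < M ^ n) by (apply pow_lt; lra).
  exists (e / M ^ n). split; [now apply Rdiv_lt_0_compat|].
  intros v Hv Hd. split; [assumption|]. apply H.
  - intros i Hi. now apply in_lp_iter, Hv.
  - intros i Hi. replace e with (M ^ n * (e / M ^ n)) by (field; lra).
    apply (lp_dist_iter_shift p Hp (f i) (w i) M (Hf i Hi) HM (HwM i Hi)). now apply Hd.
Qed.

(* [XN_open] ignores the components of index outside [1..N]. *)
Lemma XN_open_ext (U : (nat -> I -> C) -> Prop) u v : XN_open p N U -> U u ->
  (forall i, (1 <= i <= N)%nat -> u i = v i) -> U v.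
Proof.
  intros [HU1 HU2] Hu Huv. destruct (HU2 u Hu) as (e & He & H). apply H.
  - intros i Hi. rewrite <- Huv by assumption. now apply HU1.
  - intros i Hi. rewrite <- Huv by assumption. now apply lp_dist_refl.
Qed.

Lemma iter_period (S : (I -> C) -> I -> C) n y q :
  Nat.iter n S y = y -> Nat.iter (q * n) S y = y.
Proof.
  intros H. induction q as [|q IH]; [reflexivity|].
  simpl. now rewrite Nat.iter_add, IH, H.
Qed.

(** The cylinder over [U] in coordinate [i] is open in the product and has the same visit times,
    since all iterates of [x] stay in l^p. *)
Lemma disj_reit_component i : (1 <= i <= N)%nat ->
  disj_reit_hypercyclic p N T -> reit_hypercyclic p (T i).
Proof.
  intros Hi (x & Hx & H). exists x. split; [assumption|]. intros U [HU1 HU2] [u Hu].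
  replace (fun n => U (Nat.iter n (T i) x))
    with (fun n => in_lpN (fun k => Nat.iter n (T k) x) /\ U (Nat.iter n (T i) x)).
  - apply (H (fun v => in_lpN v /\ U (v i))).
    + split; [tauto|]. intros v [Hv HUv]. destruct (HU2 _ HUv) as (e & He & Hball).
      exists e. split; [assumption|]. intros v' Hv' Hd. split; [assumption|].
      apply Hball; auto.
    + exists (fun _ => u). auto.
  - apply functional_extensionality. intros n. apply propositional_extensionality.
    split; [tauto|]. intros HU. split; [|assumption]. intros k Hk. now apply in_lp_iter.
Qed.

(* A hypercyclic orbit shadows a periodic tuple of [U] for arbitrarily long times. *)
Lemma disj_reit_of_components :
  (forall i, (1 <= i <= N)%nat -> reit_hypercyclic p (T i)) ->
  disj_hypercyclic p N T -> disj_reit_hypercyclic p N T.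
Proof.
  intros Hreit (x & Hx & Hhyp). exists x. split; [assumption|].
  intros U HU [u Hu]. assert (Hlp := proj1 HU u Hu).
  destruct (proj2 HU u Hu) as (e & He & Hball).
  destruct common_weight_bound as (M & HM & HwM).
  destruct (uniform_bound (fun i a => forall n, (a <= n)%nat -> exists y,
    in_lp p y /\ lp_dist_lt p (u i) y e /\ Nat.iter n (T i) y = y) N) as [a Hper].
  { intros i a b Hab H n Hn. apply H. lia. }
  { intros i Hi.
    exact (reit_hypercyclic_periodic_approx p Hp (f i) (w i) M (Hf i Hi) HM (HwM i Hi)
             (proj2 (Hw i Hi)) (Hreit i Hi) (u i) (Hlp i Hi) e He). }
  (* A common period for all components, above the threshold and nonzero. *)
  set (n := S a).
  assert (Hper' : forall i, exists y, (1 <= i <= N)%nat ->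
    in_lp p y /\ lp_dist_lt p (u i) y e /\ Nat.iter n (T i) y = y).
  { intros i. destruct (classic (1 <= i <= N)%nat) as [Hi|Hi].
    - destruct (Hper i Hi n) as [y Hy]; [unfold n; lia|]. now exists y.
    - exists x. tauto. }
  set (y := fun i => proj1_sig (constructive_indefinite_description _ (Hper' i))).
  assert (Hy : forall i, (1 <= i <= N)%nat ->
    in_lp p (y i) /\ lp_dist_lt p (u i) (y i) e /\ Nat.iter n (T i) (y i) = y i)
    by (intros i; exact (proj2_sig (constructive_indefinite_description _ (Hper' i)))).
  assert (HUy : U y) by (apply Hball; intros i Hi; apply (Hy i Hi)).
  (* Tuples that remain in [U] at the times [0], [n], ..., [L n] form an open set, a finite
     intersection of preimages, which contains [y]. *)
  assert (HV : forall L, XN_open p N (fun v => in_lpN v /\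
    forall q, (q <= L)%nat -> U (fun i => Nat.iter (q * n) (T i) (v i)))).
  { intros L. induction L as [|L IH].
    - apply (XN_open_iff _ _ (XN_open_preimage U (0 * n) HU)). intros v.
      split; intros [H1 H2]; split; auto.
      intros q Hq. now replace q with 0%nat by lia.
    - apply (XN_open_iff _ _ (XN_open_inter _ _ IH (XN_open_preimage U (S L * n) HU))).
      intros v. split.
      + intros [[H1 H2] [_ H3]]. split; [assumption|]. intros q Hq.
        destruct (Nat.eq_dec q (S L)) as [->|Hne]; [assumption | apply H2; lia].
      + intros [H1 H2]. repeat split; auto. }
  apply (upper_Bd_pos_progressions _ n); [unfold n; lia|].
  intros K m0.
  (* Hypercyclicity gives no lower bound on [m]. Asking for [m0] further terms and dropping them
     from the front starts the progression at [m + m0 n], which is at least [m0]. *)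
  destruct (Hhyp _ (HV (K + m0)%nat)) as (m & _ & Hm).
  { exists y. split; [intros i Hi; apply (Hy i Hi)|]. intros q _.
    apply (XN_open_ext U y); [assumption | assumption |].
    intros i Hi. symmetry. apply iter_period, (Hy i Hi). }
  exists (m + m0 * n)%nat. split; [unfold n; lia|]. intros q Hq.
  specialize (Hm (q + m0)%nat ltac:(lia)). simpl in Hm.
  replace (fun i => Nat.iter (m + m0 * n + q * n) (T i) x)
    with (fun i => Nat.iter ((q + m0) * n) (T i) (Nat.iter m (T i) x)); [exact Hm|].
  apply functional_extensionality. intros i. rewrite <- Nat.iter_add.
  apply (f_equal (fun k => Nat.iter k (T i) x)). lia.
Qed.

(** Common to both index sets, since only injectivity of the maps enters. Disjoint hypercyclicity
    follows because sets of positive density are nonempty. *)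
Lemma disj_reit_hypercyclic_iff :
  disj_reit_hypercyclic p N T <->
  (forall i, (1 <= i <= N)%nat -> reit_hypercyclic p (T i)) /\ disj_hypercyclic p N T.
Proof.
  split.
  - intros H. split.
    + intros i Hi. now apply disj_reit_component.
    + destruct H as (x & Hx & H). exists x. split; [assumption|].
      intros U HU HU0. now apply upper_Bd_pos_nonempty, H.
  - intros [H1 H2]. now apply disj_reit_of_components.
Qed.

End Disjoint.

Theorem corollary3p5 :
  (forall (p : R) (N : nat) (f : nat -> nat -> nat) (w : nat -> nat -> C),
     1 < p -> (2 < N)%nat ->
     (forall i, (1 <= i <= N)%nat -> unilateral_wps_data (f i) (w i)) ->
     (disj_reit_hypercyclic p N (fun i => pseudo_shift (f i) (w i)) <->
      (forall i, (1 <= i <= N)%nat -> reit_hypercyclic p (pseudo_shift (f i) (w i)))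
      /\ disj_hypercyclic p N (fun i => pseudo_shift (f i) (w i))))
  /\
  (forall (p : R) (N : nat) (f : nat -> Z -> Z) (w : nat -> Z -> C),
     1 < p -> (2 < N)%nat ->
     (forall i, (1 <= i <= N)%nat -> bilateral_wps_data (f i) (w i)) ->
     (disj_reit_hypercyclic p N (fun i => pseudo_shift (f i) (w i)) <->
      (forall i, (1 <= i <= N)%nat -> reit_hypercyclic p (pseudo_shift (f i) (w i)))
      /\ disj_hypercyclic p N (fun i => pseudo_shift (f i) (w i)))).
Proof.
  split; intros p N f w Hp _ H; apply disj_reit_hypercyclic_iff; try assumption;
    intros i Hi; destruct (H i Hi) as [Hinj Hw]; try assumption.
  (* In the bilateral case injectivity comes from the left inverse. *)
  destruct Hinj as (g & Hg & _). intros j k E. now rewrite <- (Hg j), <- (Hg k), E.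
Qed.
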